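(* There exists an absolute constant $C>0$ such that the following holds. Let $d\in\mathbb{N}$ and let $F$ be a symmetric probability distribution on $\mathbb{R}^d$ with $\operatorname{supp}F\subset\mathbb{Z}^d$ and $q:=F\{\vec 0\}\in(0,1)$. Let $D=\exp\big((F-I)-\tfrac12(F-I)^{*2}\big)$. Then, for any $n\in\mathbb{N}$, $$d_{TV}(F^{*n},D^{*n})\leq \frac{15.75\,\delta^3(nq/6)}{q^{7/2}\,n^2}\left(1+\frac{C}{q^{7/2}\sqrt{n}}\right)+\frac{C(1-q)^{15/2}}{q^8\,n^2\sqrt{n}}.$$
   Context: Symmetric means $F\{\vec x\}=F\{-\vec x\}$ for all $\vec x\in\mathbb{Z}^d$. $I$ is the distribution concentrated at $\vec 0\in\mathbb{R}^d$; $*$ is convolution of finite signed measures on $\mathbb{R}^d$; $M^{*j}$ is the $j$-fold convolution power, $M^{*0}=I$; $\exp(M)=\sum_{j\ge 0}M^{*j}/j!$, so $D^{*n}=\exp\big(n(F-I)-\tfrac n2(F-I)^{*2}\big)$, a finite signed measure. For finite signed measures of total mass one, $d_{TV}(M,V)=\frac12\|M-V\|_{TV}$, where for measures supported on $\mathbb{Z}^d$, $\|M\|_{TV}=\sum_{\vec m\in\mathbb{Z}^d}|M\{\vec m\}|$. With $p_{\vec x}=F\{\vec x\}$, for $y>0$, $$\delta(y)=\sum_{\vec x\in \operatorname{supp}F\setminus\{\vec 0\}}\min(1,\,4y\,p_{\vec x}),$$ and $\delta^3(y)=(\delta(y))^3$. *)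

(* Defs.v *)
From HB Require Import structures.
From mathcomp Require Import all_boot all_order all_algebra.
From mathcomp Require Import all_classical all_reals all_analysis.

From mathcomp Require Import ring.
Set Implicit Arguments.
Unset Strict Implicit.
Unset Printing Implicit Defensive.

Import Order.TTheory GRing.Theory Num.Theory.
Import numFieldNormedType.Exports.

Local Open Scope classical_set_scope.
Local Open Scope ring_scope.

(* The library's product sigma-algebra on d.-tuple R is the Borel
   sigma-algebra of R^d; finite signed measures are its charges. *)
Notation Rd R d := (d.-tuple R).

Section vectors.
Context {R : realType} {d : nat}.
Implicit Types x y : Rd R d.

(* Tuples carry no canonical group structure. *)
Definition vzero : Rd R d := [tuple 0 | i < d].
Definition vopp x : Rd R d := [tuple - tnth x i | i < d].
Definition vadd (xy : Rd R d * Rd R d) : Rd R d :=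
  [tuple tnth xy.1 i + tnth xy.2 i | i < d].

Definition lattice : set (Rd R d) :=
  [set x | forall i, tnth x i \is a Num.int].

Definition cube x (e : R) : set (Rd R d) :=
  [set y | forall i, `|tnth y i - tnth x i| < e].

Lemma measurable_vadd : measurable_fun [set: Rd R d * Rd R d] vadd.
Proof.
apply/measurable_fun_tnthP => i.
rewrite [X in measurable_fun _ X](_ : _ =
  ((fun xy : Rd R d * Rd R d => tnth xy.1 i) \+
   (fun xy : Rd R d * Rd R d => tnth xy.2 i))); last first.
  by apply/funext => xy /=; rewrite tnth_mktuple.
apply: measurable_realfun.measurable_funD.
  exact: (measurableT_comp (measurable_tnth i) measurable_fst).
exact: (measurableT_comp (measurable_tnth i) measurable_snd).
Qed.

End vectors.

Local Open Scope ereal_scope.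

Section convolution.
Context {R : realType} {d : nat}.
Local Notation T := (Rd R d).
Local Notation cht := (charge T R).

Definition mconv (mu nu : {finite_measure set T -> \bar R}) : set T -> \bar R :=
  pushforward (mu \x nu) vadd.

Section mconv.
Variables mu nu : {finite_measure set T -> \bar R}.

Let mconv0 : mconv mu nu set0 = 0.
Proof. by rewrite /mconv /pushforward preimage_set0 measure0. Qed.

Let mconv_ge0 A : 0 <= mconv mu nu A.
Proof. exact: (measure_ge0 (mu \x nu)). Qed.

Let mconv_sigma_additive : semi_sigma_additive (mconv mu nu).
Proof.
move=> F mF tF mUF; rewrite /mconv /pushforward preimage_bigcup.
apply: measure_semi_sigma_additive.
- by move=> i; rewrite -[X in measurable X]setTI; exact: measurable_vadd.
- apply/trivIsetP => /= i j _ _ ij; rewrite -preimage_setI.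
  by move/trivIsetP : tF => /(_ _ _ _ _ ij) ->//; rewrite preimage_set0.
- by rewrite -preimage_bigcup -[X in measurable X]setTI; exact: measurable_vadd.
Qed.

HB.instance Definition _ := isMeasure.Build _ _ _ (mconv mu nu)
  mconv0 mconv_ge0 mconv_sigma_additive.

Lemma mconvT : mconv mu nu setT = mu setT * nu setT.
Proof.
by rewrite /mconv /pushforward preimage_setT -setXTT product_measure1E.
Qed.

Let mconv_fin : fin_num_fun (mconv mu nu).
Proof.
apply: lty_fin_num_fun.
by rewrite [ltLHS]mconvT ltey_eq fin_numM// fin_num_measure.
Qed.

HB.instance Definition _ :=
  @Measure_isFinite.Build _ _ _ (mconv mu nu) mconv_fin.

End mconv.

(* Some Hahn decomposition; the induced Jordan decomposition M = M^+ - M^-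
   does not depend on the choice. *)
Definition hahn (M : cht) :
  {PN : set T * set T | hahn_decomposition M PN.1 PN.2}.
Proof.
by apply: cid; have [P [N PN]] := Hahn_decomposition M; exists (P, N).
Qed.

Definition cpos (M : cht) : {finite_measure set T -> \bar R} :=
  jordan_pos (svalP (hahn M)).
Definition cneg (M : cht) : {finite_measure set T -> \bar R} :=
  jordan_neg (svalP (hahn M)).

Definition csub (M N : cht) : cht := cadd M (copp N).

(* The image under addition of the signed product measure
   (M^+ - M^-) x (N^+ - N^-), expanded by bilinearity. *)
Definition conv (M N : cht) : cht :=
  csub (cadd (charge_of_finite_measure (mconv (cpos M) (cpos N)))
             (charge_of_finite_measure (mconv (cneg M) (cneg N))))
       (cadd (charge_of_finite_measure (mconv (cpos M) (cneg N)))
             (charge_of_finite_measure (mconv (cneg M) (cpos N)))).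

Definition unit_mass : cht := charge_of_finite_measure (\d_ (@vzero R d)).

Fixpoint conv_pow (M : cht) (n : nat) : cht :=
  if n is n'.+1 then conv M (conv_pow M n') else unit_mass.

Definition cvar (M : cht) : \bar R := cpos M setT + cneg M setT.

Lemma charge_jordanE (M : cht) A : measurable A -> M A = cpos M A - cneg M A.
Proof.
by move=> mA; rewrite (jordan_decomp (svalP (hahn M)) mA) /cadd /= cscaleN1.
Qed.

Lemma cposE (M : cht) A : measurable A ->
  cpos M A = M (A `&` (sval (hahn M)).1).
Proof.
by move=> mA; rewrite /cpos /= jordan_posE cjordan_posE /crestr0 mem_set.
Qed.

Lemma cnegE (M : cht) A : measurable A ->
  cneg M A = - M (A `&` (sval (hahn M)).2).
Proof.
by move=> mA; rewrite /cneg /= jordan_negE cjordan_negE /crestr0 mem_set.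
Qed.

Lemma le_cvar_add (M : cht) (a b c e : {finite_measure set T -> \bar R}) :
  (forall A, measurable A -> M A = (a A + b A) - (c A + e A)) ->
  cvar M <= (a setT + b setT) + (c setT + e setT).
Proof.
move=> ME; have [[mP _] [mN _] _ _] := svalP (hahn M).
have fD (m m' : {finite_measure set T -> \bar R}) A : measurable A ->
    m A + m' A \is a fin_num.
  by move=> mA; rewrite fin_numD !fin_num_measure.
have leT (m m' : {finite_measure set T -> \bar R}) A : measurable A ->
    m A + m' A <= m setT + m' setT.
  by move=> mA; rewrite leeD// le_measure// inE.
rewrite /cvar cposE// cnegE// !setTI !ME//.
rewrite [X in _ + X]fin_num_oppeB ?fD// (addeC (- _)).
apply: leeD; [apply: le_trans (leT a b _ mP)|apply: le_trans (leT c e _ mN)];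
  by rewrite -[leRHS]sube0; apply: leeB => //; exact: adde_ge0.
Qed.

Lemma mule_four_terms (a b c e : R) : a%:E * c%:E + b%:E * e%:E
  + (a%:E * e%:E + b%:E * c%:E) = (a%:E + b%:E) * (c%:E + e%:E).
Proof.
change ((a * c + b * e + (a * e + b * c))%:E = ((a + b) * (c + e))%:E)%R.
by congr EFin; ring.
Qed.

Lemma cvar_conv (M N : cht) : cvar (conv M N) <= cvar M * cvar N.
Proof.
apply: le_trans.
  apply: (@le_cvar_add _ (mconv (cpos M) (cpos N)) (mconv (cneg M) (cneg N))
    (mconv (cpos M) (cneg N)) (mconv (cneg M) (cpos N))) => A mA.
  by [].
rewrite [leLHS](_ : _ = (cpos M setT * cpos N setT + cneg M setT * cneg N setT)
  + (cpos M setT * cneg N setT + cneg M setT * cpos N setT)); last first.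
  by rewrite -!mconvT.
rewrite /cvar le_eqVlt; apply/orP; left; apply/eqP.
have := @fin_num_measure _ _ _ (cpos M) setT measurableT.
have := @fin_num_measure _ _ _ (cneg M) setT measurableT.
have := @fin_num_measure _ _ _ (cpos N) setT measurableT.
have := @fin_num_measure _ _ _ (cneg N) setT measurableT.
move=> /fineK <- /fineK <- /fineK <- /fineK <-.
exact: mule_four_terms.
Qed.

Lemma cvar_ge0 M : 0 <= cvar M. Proof. exact: adde_ge0. Qed.

Lemma cvar_fin M : cvar M \is a fin_num.
Proof. by rewrite fin_numD !fin_num_measure. Qed.

#[local] Hint Resolve cvar_ge0 cvar_fin : core.

Lemma cvar_pow (M : cht) j :
  cvar (conv_pow M j) <= (fine (cvar M) ^+ j * fine (cvar unit_mass))%:E.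
Proof.
elim: j => [|j IH] /=; first by rewrite mul1r fineK.
apply: (le_trans (cvar_conv _ _)).
apply: (le_trans (lee_wpmul2l (cvar_ge0 M) IH)).
by rewrite -[X in X * _](fineK (cvar_fin M)) -EFinM mulrA -exprS.
Qed.

Lemma cvar_series (M : cht) :
  \sum_(0 <= j <oo) (j`!%:R^-1)%:E * cvar (conv_pow M j) < +oo.
Proof.
set r := fine (cvar M); set b := fine (cvar unit_mass).
have r0 : (0 <= r)%R by exact: fine_ge0.
have b0 : (0 <= b)%R by exact: fine_ge0.
have e0 j : (0 <= exp_coeff r j)%R by exact: exp_coeff_ge0.
apply: (@le_lt_trans _ _ (\sum_(0 <= j <oo) b%:E * (exp_coeff r j)%:E)).
  apply: lee_nneseries => [j _ _|j _].
    by rewrite mule_ge0// lee_fin invr_ge0.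
  apply: (@le_trans _ _ ((j`!%:R^-1)%:E * (r ^+ j * b)%:E)).
    by rewrite lee_wpmul2l ?lee_fin ?invr_ge0// cvar_pow.
  by rewrite -!EFinM lee_fin /exp_coeff /= mulrA mulrC (mulrC _^-1%R).
rewrite nneseriesZl//; last by move=> j _; rewrite lee_fin.
rewrite lte_mul_pinfty ?lee_fin//.
have -> : \sum_(0 <= j <oo) (exp_coeff r j)%:E = (expR r)%:E.
  apply/cvg_lim => //.
  rewrite (_ : (fun n => _) = EFin \o series (exp_coeff r)); last first.
    by apply/funext => n /=; rewrite -sumEFin.
  by apply: cvg_EFin; [exact: nearW|exact: is_cvg_series_exp_coeff].
exact: ltry.
Qed.

Definition cexp (M : cht) (A : set T) : \bar R :=
  \sum_(0 <= j <oo) (j`!%:R^-1)%:E * conv_pow M j A.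

Section cexp_charge.
Variable M : cht.

Definition cexp_pos A : \bar R :=
  \sum_(0 <= j <oo) (j`!%:R^-1)%:E * cpos (conv_pow M j) A.

Definition cexp_neg A : \bar R :=
  \sum_(0 <= j <oo) (j`!%:R^-1)%:E * cneg (conv_pow M j) A.

Lemma invfact_ge0 j : (0 <= j`!%:R^-1 :> R)%R. Proof. by rewrite invr_ge0. Qed.

#[local] Hint Resolve invfact_ge0 : core.

Lemma cexp_posE : cexp_pos = mseries
  (fun j => mscale (NngNum (invfact_ge0 j)) (cpos (conv_pow M j))) 0.
Proof. by []. Qed.

Lemma cexp_negE : cexp_neg = mseries
  (fun j => mscale (NngNum (invfact_ge0 j)) (cneg (conv_pow M j))) 0.
Proof. by []. Qed.

Lemma cexp_pos_fin A : measurable A -> cexp_pos A \is a fin_num.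
Proof.
move=> mA; rewrite ge0_fin_numE; last by rewrite cexp_posE measure_ge0.
apply: le_lt_trans (cvar_series M); apply: lee_nneseries => j _.
  by rewrite mule_ge0// lee_fin.
rewrite lee_wpmul2l ?lee_fin//.
by rewrite (@le_trans _ _ (cpos (conv_pow M j) setT))// ?leeDl//
  le_measure// inE.
Qed.

Lemma cexp_neg_fin A : measurable A -> cexp_neg A \is a fin_num.
Proof.
move=> mA; rewrite ge0_fin_numE; last by rewrite cexp_negE measure_ge0.
apply: le_lt_trans (cvar_series M); apply: lee_nneseries => j _.
  by rewrite mule_ge0// lee_fin.
rewrite lee_wpmul2l ?lee_fin//.
by rewrite (@le_trans _ _ (cneg (conv_pow M j) setT))// ?leeDr//
  le_measure// inE.
Qed.

Lemma cexp_cvg A : measurable A ->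
  \sum_(0 <= j < n) (j`!%:R^-1)%:E * conv_pow M j A @[n --> \oo]
  --> cexp_pos A - cexp_neg A.
Proof.
move=> mA.
rewrite (_ : (fun n => _) =
  (fun n => \sum_(0 <= j < n) (j`!%:R^-1)%:E * cpos (conv_pow M j) A) \-
  (fun n => \sum_(0 <= j < n) (j`!%:R^-1)%:E * cneg (conv_pow M j) A));
  last first.
  apply/funext => n /=; elim: n => [|n IH]; first by rewrite !big_geq// sube0.
  rewrite !big_nat_recr//= IH charge_jordanE//.
  rewrite muleBr//; last first.
    by rewrite fin_num_adde_defl// fin_numN fin_num_measure.
  rewrite fin_num_oppeD; last by rewrite fin_numM// fin_num_measure.
  by rewrite addeACA.
apply: (@cvgeB _ _ _ _ _ _ (cexp_pos A) (cexp_neg A)).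
- by rewrite fin_num_adde_defr// cexp_pos_fin.
- by apply: is_cvg_nneseries => j _ _; rewrite mule_ge0// lee_fin.
- by apply: is_cvg_nneseries => j _ _; rewrite mule_ge0// lee_fin.
Qed.

Lemma cexpE A : measurable A -> cexp M A = cexp_pos A - cexp_neg A.
Proof. by move=> mA; apply/cvg_lim => //; exact: cexp_cvg. Qed.

Lemma cexp0 : cexp M set0 = 0.
Proof. by rewrite cexpE// cexp_posE cexp_negE !measure0 sube0. Qed.

Lemma cexp_fin A : measurable A -> cexp M A \is a fin_num.
Proof. by move=> mA; rewrite cexpE// fin_numB cexp_pos_fin ?cexp_neg_fin. Qed.

Lemma cexp_sigma_additive : semi_sigma_additive (cexp M).
Proof.
move=> F mF tF mUF; rewrite cexpE//.
rewrite (_ : (fun n => _) = (fun n => \sum_(0 <= i < n) cexp_pos (F i)) \-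
  (fun n => \sum_(0 <= i < n) cexp_neg (F i))); last first.
  apply/funext => n /=; elim: n => [|n IH]; first by rewrite !big_geq// sube0.
  rewrite !big_nat_recr//= IH cexpE//.
  by rewrite fin_num_oppeD ?cexp_neg_fin// addeACA.
apply: (@cvgeB _ _ _ _ _ _ (cexp_pos _) (cexp_neg _)).
- by rewrite fin_num_adde_defr// cexp_pos_fin.
- by rewrite cexp_posE; exact: measure_semi_sigma_additive.
- by rewrite cexp_negE; exact: measure_semi_sigma_additive.
Qed.

HB.instance Definition _ := isCharge.Build _ _ _ (cexp M)
  cexp0 cexp_fin cexp_sigma_additive.

End cexp_charge.

(* This is the total variation norm only for charges concentrated on the
   lattice. *)
Definition tv_norm (M : cht) : \bar R := \esum_(m in lattice) `|M [set m]|.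

Definition dTV (M N : cht) : \bar R := 2^-1%:E * tv_norm (csub M N).

(* The topological support: every neighbourhood has positive measure. *)
Definition supp (F : set T -> \bar R) : set T :=
  [set x | forall e : R, (0 < e)%R -> 0 < F (cube x e)].

Definition symmetric_on_lattice (F : set T -> \bar R) : Prop :=
  forall x, lattice x -> F [set x] = F [set vopp x].

Definition delta (F : set T -> \bar R) (y : R) : R :=
  fine (\esum_(x in supp F `\` [set vzero])
    (Num.min 1 (4 * y * fine (F [set x])))%:E).

Definition approx_D (F : cht) : cht :=
  cexp (csub (csub F unit_mass)
             (cscale 2^-1 (conv_pow (csub F unit_mass) 2))).

End convolution.

(* Main.v *)
(** Put [u = F - I] and [p = 1 - q], and compute in the convolution algebra
    l^1(Z^d). Expanding the exponential, [E = F - D = u^3/3 + O(u^4)], and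
    F^n - D^n = n E F^(n-1) - E^2 sum_(k < n) sum_(j < k) F^(n-2-j) D^j,
    so it suffices to bound the norms of u^a F^i D^j.

    Smoothing by F. If F = al + be X + B with |X| <= 1 and al + be + |B| <= 1,
    then C(M+k, k) (al be)^k (X - 1)^k F^M is obtained from the expansion of
    F^(M+k) by weighting each term with an elementary symmetric function of
    centred, independent statistics; Cauchy-Schwarz then bounds its norm.
    Taking for X the point mass at x and at -x, and summing
    u = 1/2 sum_x F{x} (X + X^-1 - 2), yields
    |u F^(2M)| <= 1/2 sum_(x <> 0) min (4 F{x}) (1 / (q (M+1))), and with
    n - 1 split into six blocks the main term n/3 |u^3 F^(n-1)| / 2 is at most
    4.5 delta(nq/6)^3 / (q^3 n^2). Taking X = (F - q) / p gives the cruder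
    |u F^M|^2 <= p / (q (M+1)), which pays for the extra powers of u.

    Smoothing by D. Since exp (y u) is a Poisson mixture of the powers of the
    lazy law 1 + e u, the same bounds hold for it. In
    D^l = exp (l u) exp (- l u^2 / 2) the part exp ((q/4) l u) is kept for
    smoothing; the remaining factor has norm at most 2 / q, because
    |u^(2m) exp (y u)|^2 <= (2m)! (p / ((1 - e p) y))^(2m). *)

Require Import Defs.
From HB Require Import structures.
From mathcomp Require Import all_boot all_order all_algebra.
From mathcomp Require Import all_classical all_reals all_analysis.
From mathcomp Require Import ring lra zify.
Import Order.TTheory GRing.Theory Num.Theory.
Import numFieldNormedType.Exports.
Local Open Scope classical_set_scope.
Local Open Scope ring_scope.

Set Implicit Arguments.
Unset Strict Implicit.
Unset Printing Implicit Defensive.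


(** * Absolutely summable families *)

(** The exponent of [D] is the degree-two Taylor polynomial of [log (1 + u)], which is why the
    discrepancy [E] starts at order three with coefficient 1/3. The obstacle is the explicit
    constant. Smoothing by [D] costs numerical factors and powers of [1/q], so it must not touch the
    leading term. The telescoping identity is therefore pushed to second order: the term linear in
    [E] contains powers of [F] only, and [D] appears only next to [E^2]. The powers of [n] balance
    as follows. Three factors [u] are always estimated through [delta] and give [n^-3]; every
    further factor [u] is estimated crudely and gives [n^(-1/2)]. Hence [n u^3] yields [n^-2],
    [n u^4] yields [n^(-5/2)], and the [n^2] terms with [u^6] yield [n^2 n^-3 n^(-3/2) = n^(-5/2)].
    The leading constant 4.5 leaves room below 15.75, and the correction terms are absorbed by [C]
    in the factor [1 + C / (q^(7/2) sqrt n)]. *)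

Section abs_sum.
Context {R : realType}.
Implicit Types I J : choiceType.

Definition abs_sum I (f : I -> R) : \bar R := \esum_(i in [set: I]) `|f i|%:E.

Definition abs_summable I (f : I -> R) : Prop := (abs_sum f < +oo)%E.

(** An unconditional sum over an unordered index type. Since [fine] sends an infinite value to 0,
    the result is meaningful only for summable families. *)
Definition rsum I (f : I -> R) : R :=
  fine (\esum_(i in [set: I]) (Num.max (f i) 0)%:E)
  - fine (\esum_(i in [set: I]) (Num.max (- f i) 0)%:E).

Lemma abs_sum_ge0 I (f : I -> R) : (0 <= abs_sum f)%E.
Proof. by apply: esum_ge0 => i _; rewrite lee_fin. Qed.

Lemma abs_sum_fin I (f : I -> R) : abs_summable f -> abs_sum f \is a fin_num.
Proof. by move=> fs; rewrite ge0_fin_numE// abs_sum_ge0. Qed.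

Lemma le_abs_sum I (f g : I -> R) : (forall i, `|f i| <= `|g i|) ->
  (abs_sum f <= abs_sum g)%E.
Proof. by move=> fg; apply: le_esum => i _; rewrite lee_fin. Qed.

Lemma le_abs_summable I (f g : I -> R) : (forall i, `|f i| <= `|g i|) ->
  abs_summable g -> abs_summable f.
Proof. by move=> fg; apply: le_lt_trans; exact: le_abs_sum. Qed.

Lemma esum_fin_nneg I (f : I -> R) : (forall i, 0 <= f i) -> abs_summable f ->
  \esum_(i in [set: I]) (f i)%:E \is a fin_num.
Proof.
move=> f0 fs; rewrite (eq_esum (b := fun i => `|f i|%:E)) ?abs_sum_fin// => i _.
by rewrite ger0_norm.
Qed.

Lemma abs_sumD I (f g : I -> R) :
  (abs_sum (fun i => (f i + g i)%R) <= abs_sum f + abs_sum g)%E.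
Proof.
rewrite -esumD => [|i _|i _]; rewrite ?lee_fin//.
by apply: le_esum => i _; rewrite -EFinD lee_fin ler_normD.
Qed.

Lemma abs_summableD I (f g : I -> R) : abs_summable f -> abs_summable g ->
  abs_summable (fun i => f i + g i).
Proof.
by move=> fs gs; apply: (le_lt_trans (abs_sumD f g)); rewrite lte_add_pinfty.
Qed.

Lemma abs_summableN I (f : I -> R) : abs_summable f ->
  abs_summable (fun i => - f i).
Proof. by apply: le_abs_summable => i; rewrite normrN. Qed.

Lemma abs_sumZ I (c : R) (f : I -> R) :
  abs_sum (fun i => c * f i) = (`|c|%:E * abs_sum f)%E.
Proof.
rewrite /abs_sum; have [->|c0] := eqVneq c 0.
  by rewrite normr0 mul0e esum1// => i _; rewrite mul0r normr0.
have le (k : R) (g : I -> R) : (0 < k) -> (forall i, 0 <= g i) ->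
    (\esum_(i in [set: I]) (k * g i)%:E <= k%:E * \esum_(i in [set: I]) (g i)%:E)%E.
  move=> k0 g0; apply: ge_ereal_sup => _ [X [finX _] <-].
  under eq_fsbigr do rewrite EFinM.
  rewrite -ge0_mule_fsumr; last by move=> i; rewrite lee_fin.
  rewrite lee_wpmul2l ?lee_fin ?(ltW k0)//.
  by apply: ereal_sup_ubound; exists X.
have nc : 0 < `|c| by rewrite normr_gt0.
apply/eqP; rewrite eq_le; apply/andP; split.
  by under eq_esum do rewrite normrM; apply: le.
rewrite -lee_pdivlMl//.
rewrite [X in (X <= _)%E](eq_esum (b := fun i => (`|c|^-1 * `|c * f i|)%:E)).
  by apply: le; rewrite ?invr_gt0.
by move=> i _; rewrite normrM mulrA mulVf ?mul1r// gt_eqF.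
Qed.

Lemma abs_summableZ I (c : R) (f : I -> R) : abs_summable f ->
  abs_summable (fun i => c * f i).
Proof.
move=> fs; rewrite /abs_summable abs_sumZ lte_mul_pinfty ?lee_fin ?abs_sum_fin//.
Qed.

Lemma abs_summable_norm I (f : I -> R) : abs_summable f ->
  abs_summable (fun i => `|f i|).
Proof. by apply: le_abs_summable => i; rewrite normr_id. Qed.

(** From [f = g - h] one gets [f^+ + h = f^- + g], an identity between nonnegative families, where
    sums are additive. Linearity of [rsum] follows from this freedom of splitting. *)
Lemma rsum_split I (f g h : I -> R) : (forall i, f i = g i - h i) ->
  (forall i, 0 <= g i) -> (forall i, 0 <= h i) ->
  abs_summable g -> abs_summable h ->
  rsum f = fine (\esum_(i in [set: I]) (g i)%:E)
         - fine (\esum_(i in [set: I]) (h i)%:E).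
Proof.
move=> fE g0 h0 gs hs.
have fs : abs_summable f.
  rewrite (_ : f = fun i => g i + - h i); last exact/funext.
  by apply: abs_summableD => //; exact: abs_summableN.
have m0 (k : I -> R) i : 0 <= Num.max (k i) 0 by rewrite le_max lexx orbT.
have mle (x : R) : `|Num.max x 0| <= `|x|.
  by case: (leP x 0) => h1; rewrite ?normr0.
have ps : abs_summable (fun i => Num.max (f i) 0).
  by apply: le_abs_summable (fs) => i.
have ns : abs_summable (fun i => Num.max (- f i) 0).
  by apply: le_abs_summable (fs) => i; rewrite -[leRHS]normrN.
rewrite /rsum; apply/eqP; rewrite subr_eq addrAC eq_sym subr_eq; apply/eqP.
rewrite -!fineD ?esum_fin_nneg//; last by move=> i; exact: (m0 (\- f)).
congr fine; rewrite -!esumD; do ?by move=> i _; rewrite lee_fin ?(m0 f) ?(m0 (\- f)).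
apply: eq_esum => i _; rewrite -!EFinD; congr EFin; rewrite fE.
have [] := leP (g i - h i) 0 => h1; have [] := leP (- (g i - h i)) 0 => h2; lra.
Qed.

Lemma rsum_nneg I (f : I -> R) : (forall i, 0 <= f i) -> abs_summable f ->
  rsum f = fine (\esum_(i in [set: I]) (f i)%:E).
Proof.
move=> f0 fs; rewrite (@rsum_split _ f f (fun=> 0))//; first last.
- by rewrite /abs_summable /abs_sum esum1// => i _; rewrite normr0.
- by move=> i; rewrite subr0.
by rewrite [X in _ - fine X]esum1// subr0.
Qed.

Lemma rsum_nnegE I (f : I -> R) : (forall i, 0 <= f i) -> abs_summable f ->
  (rsum f)%:E = \esum_(i in [set: I]) (f i)%:E.
Proof. by move=> f0 fs; rewrite rsum_nneg// fineK// esum_fin_nneg. Qed.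

Lemma rsum_ge0 I (f : I -> R) : (forall i, 0 <= f i) -> 0 <= rsum f.
Proof.
move=> f0; rewrite /rsum [X in _ - fine X]esum1 => [|i _].
  by rewrite subr0; apply/fine_ge0/esum_ge0 => i _; rewrite lee_fin le_max lexx orbT.
by rewrite max_r// oppr_le0.
Qed.

Lemma rsum_norm I (f : I -> R) : abs_summable f ->
  (rsum (fun i => `|f i|))%:E = abs_sum f.
Proof. by move=> fs; rewrite rsum_nnegE//; exact: abs_summable_norm. Qed.

Lemma pos_summable I (f : I -> R) : abs_summable f ->
  abs_summable (fun i => Num.max (f i) 0).
Proof.
by apply: le_abs_summable => i; case: (leP (f i) 0) => h; rewrite ?normr0.
Qed.

Lemma neg_summable I (f : I -> R) : abs_summable f ->
  abs_summable (fun i => Num.max (- f i) 0).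
Proof. by move=> /abs_summableN; exact: pos_summable. Qed.

Lemma max0_ge0 (x : R) : 0 <= Num.max x 0.
Proof. by rewrite le_max lexx orbT. Qed.

Lemma max0_sub (x : R) : x = Num.max x 0 - Num.max (- x) 0.
Proof.
by have [] := leP x 0 => h1; have [] := leP (- x) 0 => h2; lra.
Qed.

#[local] Hint Resolve max0_ge0 : core.

Lemma rsumD I (f g : I -> R) : abs_summable f -> abs_summable g ->
  rsum (fun i => f i + g i) = rsum f + rsum g.
Proof.
move=> fs gs.
rewrite (@rsum_split _ _ (fun i => Num.max (f i) 0 + Num.max (g i) 0)
  (fun i => Num.max (- f i) 0 + Num.max (- g i) 0)); last 1 first.
- by apply: abs_summableD; exact: neg_summable.
- rewrite (eq_esum (b := fun i => ((Num.max (f i) 0)%:E + (Num.max (g i) 0)%:E)%E))//.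
  rewrite [X in _ - fine X](eq_esum (b := fun i => ((Num.max (- f i) 0)%:E + (Num.max (- g i) 0)%:E)%E))//.
  rewrite !esumD; do ?by move=> i _; rewrite lee_fin.
  rewrite !fineD ?esum_fin_nneg//; do ?[exact: pos_summable|exact: neg_summable].
  by rewrite /rsum; lra.
- by move=> i; rewrite {1}(max0_sub (f i)) {1}(max0_sub (g i)); lra.
- by move=> i; rewrite addr_ge0.
- by move=> i; rewrite addr_ge0.
- by apply: abs_summableD; exact: pos_summable.
Qed.

Lemma rsumN I (f : I -> R) : rsum (fun i => - f i) = - rsum f.
Proof.
rewrite /rsum opprB; congr (_ - fine _).
by apply: eq_esum => i _; rewrite opprK.
Qed.

Lemma eq_rsum I (f g : I -> R) : f =1 g -> rsum f = rsum g.
Proof. by move=> /funext ->. Qed.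

Lemma le_rsum I (f g : I -> R) : abs_summable f -> abs_summable g ->
  (forall i, f i <= g i) -> rsum f <= rsum g.
Proof.
move=> fs gs fg; rewrite -subr_ge0 -rsumN -rsumD//; last exact: abs_summableN.
rewrite rsum_nneg; first by apply/fine_ge0/esum_ge0 => i _; rewrite lee_fin subr_ge0.
- by move=> i; rewrite subr_ge0.
- by apply: abs_summableD => //; exact: abs_summableN.
Qed.

Lemma rsum0 I : rsum (fun _ : I => 0) = 0.
Proof. by rewrite /rsum oppr0 subrr. Qed.

Lemma abs_summable0 I : abs_summable (fun _ : I => 0).
Proof. by rewrite /abs_summable /abs_sum esum1// => i _; rewrite normr0. Qed.

Lemma ler_norm_rsum I (f : I -> R) : abs_summable f ->
  `|rsum f| <= rsum (fun i => `|f i|).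
Proof.
move=> fs; have ns := abs_summable_norm fs.
rewrite ler_norml -rsumN !le_rsum//.
- by move=> i; rewrite ler_norm.
- exact: abs_summableN.
- by move=> i; rewrite lerNl -normrN ler_norm.
Qed.

Lemma rsumZ I c (f : I -> R) : abs_summable f ->
  rsum (fun i => c * f i) = c * rsum f.
Proof.
move=> fs.
have pos (k : R) (g : I -> R) : 0 <= k -> (forall i, 0 <= g i) -> abs_summable g ->
    rsum (fun i => k * g i) = k * rsum g.
  move=> k0 g0 gs; apply: EFin_inj; rewrite rsum_nnegE; last exact: abs_summableZ.
    rewrite EFinM rsum_nnegE//; have := abs_sumZ k g; rewrite /abs_sum ger0_norm//.
    rewrite (eq_esum (b := fun i => (k * g i)%:E)) => [->|i _].
      by congr (_ * _)%E; apply: eq_esum => i _; rewrite ger0_norm.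
    by rewrite ger0_norm// mulr_ge0.
  by move=> i; rewrite mulr_ge0.
have gen (k : R) : 0 <= k -> rsum (fun i => k * f i) = k * rsum f.
  move=> k0; have ps := pos_summable fs; have ns := neg_summable fs.
  rewrite (_ : rsum f = rsum (fun i => Num.max (f i) 0 + - Num.max (- f i) 0)); last first.
    by apply: eq_rsum => i; exact: max0_sub.
  rewrite (eq_rsum (g := fun i => k * Num.max (f i) 0 + - (k * Num.max (- f i) 0))); last first.
    by move=> i; rewrite {1}(max0_sub (f i)) mulrBr.
  rewrite (rsumD ps (abs_summableN ns)).
  rewrite (rsumD (abs_summableZ k ps) (abs_summableN (abs_summableZ k ns))).
  rewrite !rsumN mulrBr; congr (_ - _).
    by apply: pos => // i; exact: max0_ge0.
  by apply: pos => // i; exact: max0_ge0.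
have [c0|c0] := leP 0 c; first exact: gen.
rewrite (eq_rsum (g := fun i => - (- c * f i))); last by move=> i; rewrite mulNr opprK.
by rewrite rsumN gen ?mulNr ?opprK// oppr_ge0 ltW.
Qed.

Lemma abs_sum_pt I (c : I) (x : R) :
  abs_sum (fun i => if i == c then x else 0) = `|x|%:E.
Proof.
rewrite /abs_sum (esumID [set c])// !setTI esum_set1 ?eqxx ?lee_fin//.
by rewrite esum1 ?adde0// => i /= /eqP/negbTE ->; rewrite normr0.
Qed.

Lemma abs_summable_pt I (c : I) (x : R) :
  abs_summable (fun i => if i == c then x else 0).
Proof. by rewrite /abs_summable abs_sum_pt ltry. Qed.

Lemma rsum_pt I (c : I) (f : I -> R) :
  rsum (fun i => if i == c then f i else 0) = f c.
Proof.
have E (x : R) : 0 <= x -> rsum (fun i => if i == c then x else 0) = x.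
  move=> x0; apply: EFin_inj; rewrite rsum_nnegE; last exact: abs_summable_pt.
    rewrite -[X in _ = X%:E](ger0_norm x0) -(abs_sum_pt c).
    by apply: eq_esum => i _; case: eqP; rewrite ?normr0 ?ger0_norm.
  by move=> i; case: eqP.
rewrite (eq_rsum (g := fun i => if i == c then f c else 0)); last first.
  by move=> i; case: eqP => // ->.
have [x0|x0] := leP 0 (f c); first exact: E.
rewrite -[RHS]opprK -(E (- f c)) -?rsumN ?oppr_ge0 ?ltW//.
by apply: eq_rsum => i; case: eqP; rewrite ?oppr0 ?opprK.
Qed.

Lemma esum_exchange I J (a : I -> J -> \bar R) : (forall i j, 0 <= a i j)%E ->
  \esum_(i in [set: I]) \esum_(j in [set: J]) a i j
  = \esum_(j in [set: J]) \esum_(i in [set: I]) a i j.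
Proof.
move=> a0; rewrite (esum_esum (J := fun=> setT))// (esum_esum (J := fun=> setT))//.
rewrite (reindex_esum [set z : J * I | setT z.1 /\ setT z.2] _ (fun x => (x.2, x.1)))//.
split=> //=; first by move=> [i1 i2] [j1 j2] /= _ _ [] -> ->.
by move=> [i j] _ /=; exists (j, i).
Qed.

Definition abs_summable2 I J (f : I -> J -> R) : Prop :=
  (\esum_(i in [set: I]) abs_sum (f i) < +oo)%E.

Lemma abs_summable2C I J (f : I -> J -> R) : abs_summable2 f ->
  abs_summable2 (fun j i => f i j).
Proof. by rewrite /abs_summable2 esum_exchange// => i j; rewrite lee_fin. Qed.

Lemma abs_summable2_row I J (f : I -> J -> R) i : abs_summable2 f ->
  abs_summable (f i).
Proof.
apply: le_lt_trans; rewrite (esumID [set i])//.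
rewrite setTI esum_set1 ?abs_sum_ge0// leeDl//.
  by apply: esum_ge0 => j _; exact: abs_sum_ge0.
by move=> j _; exact: abs_sum_ge0.
Qed.

Lemma abs_summable2_rsum I J (f : I -> J -> R) : abs_summable2 f ->
  abs_summable (fun i => rsum (f i)).
Proof.
move=> fs; apply: le_lt_trans (fs); apply: le_esum => i _.
rewrite -rsum_norm ?lee_fin ?ler_norm_rsum//; exact: abs_summable2_row.
Qed.

Lemma le_abs_summable2 I J (f g : I -> J -> R) :
  (forall i j, `|f i j| <= `|g i j|) -> abs_summable2 g -> abs_summable2 f.
Proof.
by move=> fg; apply: le_lt_trans; apply: le_esum => i _; exact: le_abs_sum.
Qed.

(** Tonelli applied to the positive and the negative part separately; both are dominated by [f]. *)
Lemma rsum_exchange I J (f : I -> J -> R) : abs_summable2 f ->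
  rsum (fun i => rsum (f i)) = rsum (fun j => rsum (fun i => f i j)).
Proof.
have pos I' J' (g : I' -> J' -> R) : (forall i j, 0 <= g i j) -> abs_summable2 g ->
    (rsum (fun i => rsum (g i)))%:E
    = \esum_(i in [set: I']) \esum_(j in [set: J']) (g i j)%:E.
  move=> g0 gs; rewrite rsum_nnegE; last exact: abs_summable2_rsum.
    by apply: eq_esum => i _; rewrite rsum_nnegE//; exact: abs_summable2_row gs.
  move=> i; rewrite -lee_fin rsum_nnegE//; last exact: abs_summable2_row gs.
  by apply: esum_ge0 => j _; rewrite lee_fin.
have posE (g : I -> J -> R) : (forall i j, 0 <= g i j) -> abs_summable2 g ->
    rsum (fun i => rsum (g i)) = rsum (fun j => rsum (fun i => g i j)).
  move=> g0 gs; apply: EFin_inj; rewrite !pos//; last exact: abs_summable2C.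
  by rewrite esum_exchange// => i j; rewrite lee_fin.
move=> fs.
have ps : abs_summable2 (fun i j => Num.max (f i j) 0).
  by apply: le_abs_summable2 (fs) => i j; case: (leP (f i j) 0) => h; rewrite ?normr0.
have ns : abs_summable2 (fun i j => - Num.max (- f i j) 0).
  apply: le_abs_summable2 (fs) => i j; rewrite normrN -[leRHS]normrN.
  by case: (leP (- f i j) 0) => h; rewrite ?normr0.
have sub I' J' (g : I' -> J' -> R) : abs_summable2 (fun i j => Num.max (g i j) 0) ->
   abs_summable2 (fun i j => - Num.max (- g i j) 0) ->
   rsum (fun i => rsum (g i)) = rsum (fun i => rsum (fun j => Num.max (g i j) 0))
     - rsum (fun i => rsum (fun j => Num.max (- g i j) 0)).
  move=> gp gn; rewrite -rsumN -rsumD; last 2 first.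
  - exact: abs_summable2_rsum gp.
  - under eq_fun do rewrite -rsumN; exact: abs_summable2_rsum gn.
  apply: eq_rsum => i; rewrite -rsumN -rsumD; last 2 first.
  - exact: abs_summable2_row gp.
  - exact: abs_summable2_row gn.
  by apply: eq_rsum => j; exact: max0_sub.
rewrite (sub _ _ _ ps ns) (sub _ _ _ (abs_summable2C ps) (abs_summable2C ns)).
congr (_ - _); first exact: posE.
apply: posE => [i j|]; first exact: max0_ge0.
by apply: le_abs_summable2 (ns) => i j; rewrite normrN.
Qed.

Lemma esum_bij I J (e : I -> J) (a : J -> \bar R) : bijective e ->
  \esum_(j in [set: J]) a j = \esum_(i in [set: I]) a (e i).
Proof.
move=> [g eK gK]; apply: reindex_esum; split=> //=.
  by move=> i j _ _ /(can_inj eK).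
by move=> j _; exists (g j).
Qed.

Lemma abs_sum_bij I J (e : I -> J) (f : J -> R) : bijective e ->
  abs_sum (fun i => f (e i)) = abs_sum f.
Proof. by move=> be; rewrite /abs_sum (esum_bij _ be). Qed.

Lemma rsum_bij I J (e : I -> J) (f : J -> R) : bijective e ->
  rsum (fun i => f (e i)) = rsum f.
Proof. by move=> be; rewrite /rsum; congr (fine _ - fine _); rewrite (esum_bij _ be). Qed.

Lemma rsum_nat_cvg (f : nat -> R) : abs_summable f -> series f @ \oo --> rsum f.
Proof.
move=> fs.
have pos (g : nat -> R) : (forall i, 0 <= g i) -> abs_summable g ->
    series g @ \oo --> fine (\esum_(i in [set: nat]) (g i)%:E).
  move=> g0 gs; have gfin := esum_fin_nneg g0 gs.
  have h : \sum_(0 <= i < n) (g i)%:E @[n --> \oo] --> \esum_(i in [set: nat]) (g i)%:E.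
    by rewrite -nneseries_esumT//; apply: is_cvg_nneseries => i _ _; rewrite lee_fin.
  suff /fine_cvgP[_] : (series g n)%:E @[n --> \oo]
      --> (fine (\esum_(i in [set: nat]) (g i)%:E))%:E by [].
  rewrite fineK//.
  rewrite (_ : (fun n => (series g n)%:E) = (fun n => \sum_(0 <= i < n) (g i)%:E)%E)//.
  by apply/funext => n; rewrite -sumEFin.
rewrite (_ : series f = series (fun i => Num.max (f i) 0)
                        \- series (fun i => Num.max (- f i) 0)); last first.
  apply/funext => n /=; rewrite /series/= -sumrB.
  by apply: eq_bigr => i _; exact: max0_sub.
apply: cvgB; apply: pos.
- by move=> i; exact: max0_ge0.
- exact: pos_summable.
- by move=> i; exact: max0_ge0.
- exact: neg_summable.
Qed.

Lemma abs_summable_nat (f : nat -> R) (c : R) : (forall i, 0 <= f i) ->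
  (forall n, series f n <= c) -> abs_summable f.
Proof.
move=> f0 fc; rewrite /abs_summable /abs_sum.
rewrite (eq_esum (b := EFin \o f)); last by move=> i _ /=; rewrite ger0_norm.
rewrite -nneseries_esumT; last by move=> i; rewrite /= lee_fin.
apply: (@le_lt_trans _ _ c%:E); last exact: ltry.
apply: lime_le; first by apply: is_cvg_nneseries => i _ _; rewrite lee_fin.
by apply: nearW => n; rewrite sumEFin lee_fin; exact: fc.
Qed.

Lemma rsum_natE (f : nat -> R) (l : R) : (forall i, 0 <= f i) ->
  series f @ \oo --> l -> abs_summable f /\ rsum f = l.
Proof.
move=> f0 fl.
have nd : nondecreasing_seq (series f).
  by apply/nondecreasing_seqP => n; rewrite /series/= big_nat_recr//= lerDl.
have fs : abs_summable f.
  apply: (@abs_summable_nat _ l) => // n; rewrite -(cvg_lim _ fl)//.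
  by apply: nondecreasing_cvgn_le => //; apply/cvg_ex; exists l.
by split=> //; apply: cvg_unique (rsum_nat_cvg fs) fl.
Qed.

Lemma abs_summableS (f : nat -> R) : abs_summable f ->
  abs_summable (fun n => f n.+1).
Proof.
move=> fs; suff le n : series (fun n => `|f n.+1|) n <= rsum (fun i => `|f i|).
  apply: (@le_abs_summable _ _ (fun n => `|f n.+1|)) => [i|]; first by rewrite normr_id.
  by apply: abs_summable_nat le => i.
have ns := abs_summable_norm fs.
have nd : nondecreasing_seq (series (fun i => `|f i|)).
  by apply/nondecreasing_seqP => m; rewrite /series/= big_nat_recr//= lerDl.
have := nondecreasing_cvgn_le nd (cvgP _ (rsum_nat_cvg ns)) n.+1.
rewrite (cvg_lim _ (rsum_nat_cvg ns))//; apply: le_trans.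
by rewrite /series/= [leRHS]big_nat_recl//= lerDr.
Qed.

Lemma rsumS (f : nat -> R) : abs_summable f ->
  rsum f = f 0%N + rsum (fun n => f n.+1).
Proof.
move=> fs.
have h : (fun n => f 0%N + series (fun n => f n.+1) n) @ \oo --> rsum f.
  rewrite (_ : (fun _ => _) = (fun n => series f n.+1)).
    by rewrite (cvg_shiftS (series f)); exact: rsum_nat_cvg.
  by apply/funext => n /=; rewrite /series/= big_nat_recl.
apply: cvg_unique h _ => //.
by apply: cvgD; [exact: cvg_cst|exact/rsum_nat_cvg/abs_summableS].
Qed.

Lemma rsum_truncate (f : nat -> R) n :
  rsum (fun i => if (i <= n)%N then f i else 0) = \sum_(i < n.+1) f i.
Proof.
have s m (g : nat -> R) : abs_summable (fun i => if (i <= m)%N then g i else 0).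
  elim: m => [|m IH].
    rewrite (_ : (fun _ => _) = fun i => if i == 0%N then g 0%N else 0).
      exact: abs_summable_pt.
    by apply/funext => -[|i].
  rewrite (_ : (fun _ => _) = fun i => (if (i <= m)%N then g i else 0)
      + (if i == m.+1 then g m.+1 else 0)).
    by apply: abs_summableD => //; exact: abs_summable_pt.
  apply/funext => i; rewrite leq_eqVlt ltnS; case: eqP => [->|_] /=.
    by rewrite ltnn add0r.
  by rewrite addr0.
elim: n f => [|n IH] f; rewrite (rsumS (s _ f)) big_ord_recl /=; congr (_ + _).
  by rewrite big_ord0 rsum0.
by rewrite -(IH (fun i => f i.+1)); apply: eq_rsum => i; rewrite ltnS.
Qed.

(** Needed for the Cauchy product of two series, where the [j]-th row is delayed by [j] so that
    columns become antidiagonals. *)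
Lemma rsum_delay (f : nat -> R) n : abs_summable f ->
  abs_summable (fun i => if (n <= i)%N then f (i - n)%N else 0)
  /\ rsum (fun i => if (n <= i)%N then f (i - n)%N else 0) = rsum f.
Proof.
move=> fs; elim: n => [|n [IHs IH]].
  by rewrite (_ : (fun _ => _) = f)//; apply/funext => i; rewrite subn0.
set g := fun i => _.
have gE : (fun i => g i.+1) = fun i => if (n <= i)%N then f (i - n)%N else 0.
  by apply/funext => i; rewrite /g ltnS subSS.
have gs : abs_summable g.
  apply: (@le_abs_summable _ _ (fun i => `|g i|)) => [i|]; first by rewrite normr_id.
  suff le k : series (fun i => `|g i|) k <= rsum (fun i => `|g i.+1|).
    by apply: abs_summable_nat le => i.
  case: k => [|k].
    by rewrite /series/= big_nil; exact: rsum_ge0.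
  rewrite /series/= big_nat_recl//= {1}/g ltn0 normr0 add0r.
  have ns : abs_summable (fun i => `|g i.+1|).
    by apply: abs_summable_norm; rewrite gE.
  have nd : nondecreasing_seq (series (fun i => `|g i.+1|)).
    by apply/nondecreasing_seqP => m; rewrite /series/= big_nat_recr//= lerDl.
  have := nondecreasing_cvgn_le nd (cvgP _ (rsum_nat_cvg ns)) k.
  by rewrite (cvg_lim _ (rsum_nat_cvg ns)).
by split=> //; rewrite rsumS// gE IH /g/= add0r.
Qed.

End abs_sum.

(** * The convolution algebra of summable functions *)

Section l1_def.
Variables (R : realType) (V : zmodType).

(** The convolution algebra of the discrete group [V]. Bundling summability makes convolution total,
    so the type is a commutative ring and identities between signed measures can be settled by
    [ring]. *)
Record l1 := L1 { l1_fun :> V -> R; l1_summable : abs_summable l1_fun }.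

HB.instance Definition _ := gen_eqMixin l1.
HB.instance Definition _ := gen_choiceMixin l1.

Lemma l1P (a b : l1) : (forall x, a x = b x) -> a = b.
Proof.
case: a => a sa; case: b => b sb /= ab; have ab' : a = b by exact/funext.
by case: _ / ab' in sb *; congr L1; exact: Prop_irrelevance.
Qed.

Definition l1_add (a b : l1) : l1 :=
  L1 (abs_summableD (l1_summable a) (l1_summable b)).
Definition l1_opp (a : l1) : l1 := L1 (abs_summableN (l1_summable a)).
Definition l1_pt (v : V) (c : R) : l1 := L1 (abs_summable_pt v c).

(** By translation invariance the inner sum over [z] is [|a x|] times the norm of [b], whatever [x]
    is. *)
Lemma l1_convfact (a b : l1) :
  abs_summable2 (fun x z => a x * b (z - x)).
Proof.
rewrite /abs_summable2; under eq_esum => x _.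
  rewrite abs_sumZ (abs_sum_bij (e := fun z => z - x)); first over.
  by exists (fun z => z + x) => z; rewrite ?subrK ?addrK.
have := abs_sumZ (fine (abs_sum b)) a; rewrite /abs_sum.
set s := esum _ _; set t := esum _ _ => st.
suff -> : \esum_(i in [set: V]) (`|a i|%:E * abs_sum b)%E = s.
  rewrite st -/(abs_sum a) lte_mul_pinfty ?lee_fin//; exact: (l1_summable a).
apply: eq_esum => i _; rewrite normrM mulrC EFinM; congr (_ * _)%E.
rewrite ger0_norm ?fine_ge0 ?abs_sum_ge0// fineK//.
exact: abs_sum_fin (l1_summable b).
Qed.

Definition l1_mul (a b : l1) : l1 :=
  L1 (abs_summable2_rsum (abs_summable2C (l1_convfact a b))).

Lemma l1_mulE (a b : l1) z : l1_mul a b z = rsum (fun x => a x * b (z - x)).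
Proof. by []. Qed.

Lemma l1_mulC : commutative l1_mul.
Proof.
move=> a b; apply: l1P => z; rewrite !l1_mulE.
rewrite -(rsum_bij (e := fun x => z - x)); last first.
  by exists (fun x => z - x) => x; rewrite subKr.
by apply: eq_rsum => x; rewrite subKr mulrC.
Qed.

Lemma l1_conv_row (a b : l1) z : abs_summable (fun x => a x * b (z - x)).
Proof. exact: abs_summable2_row (abs_summable2C (l1_convfact a b)). Qed.

Lemma l1_mulDl : left_distributive l1_mul l1_add.
Proof.
move=> a b c; apply: l1P => z; rewrite l1_mulE /= -rsumD; do ?exact: l1_conv_row.
by apply: eq_rsum => x; rewrite mulrDl.
Qed.

Lemma l1_mul1 : left_id (l1_pt 0 1) l1_mul.
Proof.
move=> a; apply: l1P => z; rewrite l1_mulE /=.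
rewrite (eq_rsum (g := fun x => if x == 0 then a (z - x) else 0)).
  by rewrite rsum_pt subr0.
by move=> x; case: eqP; rewrite ?mul1r ?mul0r.
Qed.

Lemma l1_mulA : associative l1_mul.
Proof.
move=> a b c; apply: l1P => z; rewrite !l1_mulE /=.
pose k x y := a x * b (y - x) * c (z - y).
(* A summable function is bounded. Replacing [c] by its bound dominates the triple product by the
   summable family of [a] and [b], which justifies the exchange of sums. *)
have bc (d : l1) : exists2 M, 0 <= M & forall y, `|d y| <= M.
  exists (fine (abs_sum d)); first by apply/fine_ge0/abs_sum_ge0.
  move=> y; rewrite -lee_fin fineK ?(abs_sum_fin (l1_summable d))//.
  rewrite /abs_sum (esumID [set y])//.
  rewrite setTI esum_set1 ?lee_fin// leeDl//.
  by apply: esum_ge0 => i _; rewrite lee_fin.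
have [M M0 cM] := bc c.
have ks : abs_summable2 k.
  have aMs : abs_summable (fun x => M * a x) by exact/abs_summableZ/l1_summable.
  apply: (@le_abs_summable2 _ _ _ _ (fun x y => L1 aMs x * b (y - x))).
    move=> x y; rewrite /k /= !normrM (ger0_norm M0) mulrAC ler_wpM2r//.
    by rewrite mulrC ler_wpM2r.
  exact: l1_convfact.
transitivity (rsum (fun x => rsum (k x))).
  apply: eq_rsum => x; rewrite -rsumZ; last exact: l1_conv_row.
  rewrite -[RHS](rsum_bij (e := fun y => y + x)); last first.
    by exists (fun y => y - x) => y; rewrite ?subrK ?addrK.
  apply: eq_rsum => y; rewrite /k mulrA addrK; congr (_ * c _).
  by rewrite opprD addrCA addrC.
rewrite rsum_exchange//; apply: eq_rsum => y.
rewrite mulrC -rsumZ; last exact: l1_conv_row.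
by apply: eq_rsum => x; rewrite /k mulrC.
Qed.

Lemma l1_addA : associative l1_add.
Proof. by move=> a b c; apply: l1P => z /=; rewrite addrA. Qed.
Lemma l1_addC : commutative l1_add.
Proof. by move=> a b; apply: l1P => z /=; rewrite addrC. Qed.
Lemma l1_add0 : left_id (L1 (@abs_summable0 R V)) l1_add.
Proof. by move=> a; apply: l1P => z /=; rewrite add0r. Qed.
Lemma l1_addN : left_inverse (L1 (@abs_summable0 R V)) l1_opp l1_add.
Proof. by move=> a; apply: l1P => z /=; rewrite addNr. Qed.

HB.instance Definition _ :=
  GRing.isZmodule.Build l1 l1_addA l1_addC l1_add0 l1_addN.

Lemma l1_one_neq0 : l1_pt 0 1 != 0.
Proof.
apply/eqP => /(congr1 (fun a : l1 => a 0)) /=; rewrite eqxx => /eqP.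
by rewrite oner_eq0.
Qed.

HB.instance Definition _ := GRing.Zmodule_isComNzRing.Build l1
  l1_mulA l1_mulC l1_mul1 l1_mulDl l1_one_neq0.

End l1_def.

Section l1_theory.
Context {R : realType} {V : zmodType}.
Local Notation A := (l1 R V).
Implicit Types a b : A.

Definition l1_cst (c : R) : A := l1_pt 0 c.
Definition l1_norm a : R := rsum (fun x => `|a x|).
Local Notation N := l1_norm.

Lemma l1_addE a b x : (a + b) x = a x + b x. Proof. by []. Qed.
Lemma l1_oppE a x : (- a) x = - a x. Proof. by []. Qed.
Lemma l1_ptE (v : V) (c : R) x : l1_pt v c x = if x == v then c else 0.
Proof. by []. Qed.
Lemma l1_cstE (c : R) x : l1_cst c x = if x == 0 then c else 0.
Proof. by []. Qed.
Lemma l1_oneE x : (1 : A) x = if x == 0 then 1 else 0. Proof. by []. Qed.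

Lemma l1_ptM (v : V) (c : R) a z : (l1_pt v c * a) z = c * a (z - v).
Proof.
rewrite [LHS]l1_mulE /= (eq_rsum (g := fun x => if x == v then c * a (z - x) else 0)).
  by rewrite rsum_pt.
by move=> x; case: eqP; rewrite ?mul0r.
Qed.

Lemma l1_cstM c a z : (l1_cst c * a) z = c * a z.
Proof. by rewrite l1_ptM subr0. Qed.

Lemma l1_cst_is_zmod_morphism : zmod_morphism l1_cst.
Proof.
by move=> c d; apply: l1P => z /=; case: eqP; rewrite ?subr0.
Qed.

Lemma l1_cst_is_monoid_morphism : monoid_morphism l1_cst.
Proof.
split=> // c d; apply: l1P => z; rewrite l1_cstM /=.
by case: eqP; rewrite ?mulr0.
Qed.

HB.instance Definition _ :=
  GRing.isZmodMorphism.Build R A l1_cst l1_cst_is_zmod_morphism.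
HB.instance Definition _ :=
  GRing.isMonoidMorphism.Build R A l1_cst l1_cst_is_monoid_morphism.

Lemma l1_norm_summable a : abs_summable (fun x => `|a x|).
Proof. exact/abs_summable_norm/l1_summable. Qed.

Lemma l1_normE a : (N a)%:E = abs_sum a.
Proof. by rewrite rsum_norm//; exact: l1_summable. Qed.

Lemma l1_norm_ge0 a : 0 <= N a.
Proof. exact: rsum_ge0. Qed.

Lemma l1_normD a b : N (a + b) <= N a + N b.
Proof. by have := abs_sumD a b; rewrite -[X in (X <= _)%E]/(abs_sum (a + b)) -!l1_normE -EFinD lee_fin. Qed.

Lemma l1_normN a : N (- a) = N a.
Proof. by apply: eq_rsum => x; rewrite normrN. Qed.

Lemma l1_normM a b : N (a * b) <= N a * N b.
Proof.
pose na : A := L1 (l1_norm_summable a); pose nb : A := L1 (l1_norm_summable b).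
have h z : `|(a * b) z| <= (na * nb) z.
  apply: le_trans (ler_norm_rsum (l1_conv_row a b z)) _.
  rewrite [leRHS]l1_mulE le_eqVlt; apply/orP; left; apply/eqP.
  by apply: eq_rsum => x; rewrite normrM.
apply: (@le_trans _ _ (rsum (na * nb))).
  by apply: le_rsum; [exact: l1_norm_summable|exact: l1_summable|].
have -> : rsum (na * nb) = rsum (fun z => rsum (fun x => na x * nb (z - x))) by [].
rewrite rsum_exchange; last exact/abs_summable2C/l1_convfact.
rewrite (eq_rsum (g := fun x => N b * `|a x|)); last first.
  move=> x; rewrite rsumZ; last first.
    rewrite /abs_summable (abs_sum_bij (e := fun z => z - x) nb).
      exact: (l1_summable nb).
    by exists (fun z => z + x) => z; rewrite ?subrK ?addrK.
  rewrite [RHS]mulrC; congr (_ * _); rewrite (rsum_bij (e := fun z => z - x) nb)//.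
  by exists (fun z => z + x) => z; rewrite ?subrK ?addrK.
by rewrite rsumZ; [rewrite mulrC|exact: l1_norm_summable].
Qed.

Lemma l1_norm_pt v c : N (l1_pt v c) = `|c|.
Proof. by apply: EFin_inj; rewrite l1_normE abs_sum_pt. Qed.

Lemma l1_norm_cst c : N (l1_cst c) = `|c|. Proof. exact: l1_norm_pt. Qed.

Lemma l1_norm1 : N 1 = 1. Proof. by rewrite [LHS]l1_norm_pt normr1. Qed.

Lemma l1_norm0 : N 0 = 0.
Proof. by rewrite /N (eq_rsum (g := fun=> 0)) ?rsum0// => x; rewrite normr0. Qed.

Lemma l1_normZ c a : N (l1_cst c * a) = `|c| * N a.
Proof.
rewrite -rsumZ; last exact: l1_norm_summable.
by apply: eq_rsum => x; rewrite l1_cstM normrM.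
Qed.

Lemma l1_normX a n : N (a ^+ n) <= N a ^+ n.
Proof.
elim: n => [|n IH]; first by rewrite !expr0 l1_norm1.
rewrite !exprS (le_trans (l1_normM _ _))// ler_wpM2l//; exact: l1_norm_ge0.
Qed.

Lemma l1_norm_sum (I : Type) (r : seq I) (P : pred I) (f : I -> A) :
  N (\sum_(i <- r | P i) f i) <= \sum_(i <- r | P i) N (f i).
Proof.
apply: (big_ind2 (fun a c => N a <= c)) => //; first by rewrite l1_norm0.
by move=> a c b d ac bd; rewrite (le_trans (l1_normD _ _))// lerD.
Qed.

Lemma l1_abs_le a x : `|a x| <= N a.
Proof.
rewrite -(rsum_pt x (fun x => `|a x|)); apply: le_rsum.
- by apply: le_abs_summable (abs_summable_pt x `|a x|) => y; case: eqP => [->|] .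
- exact: l1_norm_summable.
- by move=> y; case: eqP.
Qed.

(** A pointwise sum, with default 0 when the family is not jointly summable. Summability of the
    norms, assumed by the lemmas below, excludes the default. *)
Definition l1_sum (J : choiceType) (f : J -> A) : A :=
  match pselect (abs_summable2 (fun j x => f j x)) with
  | left h => L1 (abs_summable2_rsum (abs_summable2C h))
  | right _ => 0
  end.

Lemma l1_normable2 (J : choiceType) (f : J -> A) :
  abs_summable (fun j => N (f j)) -> abs_summable2 (fun j x => f j x).
Proof.
apply: le_lt_trans; apply: le_esum => j _.
by rewrite ger0_norm ?l1_norm_ge0// l1_normE.
Qed.

Section sums.
Context {J : choiceType}.
Implicit Types f : J -> A.

Lemma l1_sumE f x : abs_summable (fun j => N (f j)) ->
  l1_sum f x = rsum (fun j => f j x).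
Proof.
by move=> fs; rewrite /l1_sum; case: pselect => // /(_ (l1_normable2 fs)).
Qed.

Lemma l1_sum_row f x : abs_summable (fun j => N (f j)) ->
  abs_summable (fun j => f j x).
Proof.
by apply: le_abs_summable => j; rewrite (ger0_norm (l1_norm_ge0 _)) l1_abs_le.
Qed.

Lemma l1_norm_l1_sum f : abs_summable (fun j => N (f j)) ->
  N (l1_sum f) <= rsum (fun j => N (f j)).
Proof.
move=> fs; have f2 := l1_normable2 fs.
have n2 : abs_summable2 (fun j x => `|f j x|).
  by apply: le_abs_summable2 (f2) => j x; rewrite normr_id.
rewrite /(N (f _)) rsum_exchange//; apply: le_rsum.
- exact: l1_norm_summable.
- exact: abs_summable2_rsum (abs_summable2C n2).
- by move=> x; rewrite l1_sumE// ler_norm_rsum//; exact: l1_sum_row.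
Qed.

Lemma l1_norm_summableM f b : abs_summable (fun j => N (f j)) ->
  abs_summable (fun j => N (b * f j)).
Proof.
move=> fs; apply: le_abs_summable (abs_summableZ (N b) fs) => j.
by rewrite !ger0_norm ?l1_normM ?mulr_ge0 ?l1_norm_ge0.
Qed.

Lemma l1_mul_sum f b : abs_summable (fun j => N (f j)) ->
  b * l1_sum f = l1_sum (fun j => b * f j).
Proof.
move=> fs; apply: l1P => z; rewrite l1_sumE; last exact: l1_norm_summableM.
rewrite [LHS]l1_mulE.
rewrite (eq_rsum (g := fun x => rsum (fun j => b x * f j (z - x)))); last first.
  by move=> x; rewrite l1_sumE// rsumZ//; exact: l1_sum_row.
rewrite rsum_exchange// /abs_summable2 esum_exchange; last first.
  by move=> i j; rewrite lee_fin.
apply: le_lt_trans (abs_summableZ (N b) fs); apply: le_esum => j _.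
rewrite ger0_norm ?mulr_ge0 ?l1_norm_ge0//.
pose na : A := L1 (l1_norm_summable b); pose nb : A := L1 (l1_norm_summable (f j)).
rewrite (_ : esum _ _ = ((na * nb) z)%:E).
  rewrite lee_fin (le_trans (ler_norm _))// (le_trans (l1_abs_le _ _))//.
  apply: (le_trans (l1_normM _ _)).
  by rewrite /N/=; under eq_rsum do rewrite normr_id;
     under [X in _ * X <= _]eq_rsum do rewrite normr_id.
rewrite l1_mulE rsum_nnegE.
- by apply: eq_esum => x _; rewrite normrM.
- by move=> x; rewrite mulr_ge0 /=.
- exact: l1_conv_row.
Qed.

Lemma eq_l1_sum f g : f =1 g -> l1_sum f = l1_sum g.
Proof. by move=> /funext ->. Qed.

End sums.

End l1_theory.

(* Keeps unification from unfolding ring expressions down to their sums. *)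
#[global] Opaque l1_mul l1_add l1_opp l1_pt l1_sum l1_norm.

(** * The exponential in the convolution algebra *)

Section l1_exp.
Context {R : realType} {V : zmodType}.
Local Notation A := (l1 R V).
Local Notation N := (@l1_norm R V).
Implicit Types a b : A.

Lemma l1_bigE (I : Type) (r : seq I) (P : pred I) (f : I -> A) x :
  (\sum_(i <- r | P i) f i) x = \sum_(i <- r | P i) f i x.
Proof. by apply: (big_ind2 (fun (a : A) c => a x = c)) => // a c b d <- <-. Qed.

Lemma l1_sumS (f : nat -> A) : abs_summable (fun n => N (f n)) ->
  l1_sum f = f 0%N + l1_sum (fun n => f n.+1).
Proof.
move=> fs; apply: l1P => x; rewrite l1_addE !l1_sumE//; last exact: abs_summableS fs.
by rewrite rsumS//; exact: l1_sum_row.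
Qed.

Lemma exp_coeff_summable (x : R) :
  abs_summable (exp_coeff x) /\ rsum (exp_coeff x) = expR x.
Proof.
have sx : abs_summable (exp_coeff x).
  apply: (@le_abs_summable _ _ _ (exp_coeff `|x|)) => [i|].
    by rewrite /exp_coeff /= !normrM !normrX normr_id.
  apply: (proj1 (@rsum_natE _ _ (expR `|x|) _ _)); last exact: is_cvg_series_exp_coeff.
  by move=> i; exact: exp_coeff_ge0.
split=> //; apply: cvg_unique (rsum_nat_cvg sx) _ => //.
exact: is_cvg_series_exp_coeff.
Qed.

Definition l1_exp_term a n : A := l1_cst n`!%:R^-1 * a ^+ n.

Definition l1_exp a : A := l1_sum (l1_exp_term a).

Lemma l1_norm_exp_term a n : N (l1_exp_term a n) <= exp_coeff (N a) n.
Proof.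
rewrite l1_normZ /exp_coeff /= mulrC ger0_norm ?invr_ge0//.
by rewrite ler_wpM2r ?invr_ge0// l1_normX.
Qed.

Lemma l1_exp_summable a : abs_summable (fun n => N (l1_exp_term a n)).
Proof.
apply: le_abs_summable (proj1 (exp_coeff_summable (N a))) => n.
rewrite !ger0_norm ?l1_norm_ge0 ?l1_norm_exp_term//.
by rewrite exp_coeff_ge0 ?l1_norm_ge0.
Qed.

Lemma l1_expE a x : l1_exp a x = rsum (fun n => l1_exp_term a n x).
Proof. exact: (l1_sumE x (l1_exp_summable a)). Qed.

Lemma l1_exp_cst (c : R) : l1_exp (l1_cst c) = l1_cst (expR c).
Proof.
apply: l1P => x; rewrite l1_expE.
rewrite (eq_rsum (g := fun n => (if x == 0 then 1 else 0) * exp_coeff c n)).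
  have [es e] := exp_coeff_summable c.
  by rewrite rsumZ// e l1_cstE; case: eqP; rewrite ?mul1r ?mul0r.
move=> n; rewrite /l1_exp_term -rmorphXn -rmorphM /= l1_cstE /exp_coeff /=.
by case: eqP; rewrite ?mul1r ?mul0r// mulrC.
Qed.

Lemma l1_exp_termD a b n : l1_exp_term (a + b) n =
  \sum_(j < n.+1) l1_exp_term b j * l1_exp_term a (n - j).
Proof.
rewrite /l1_exp_term exprDn mulr_sumr; apply: eq_bigr => -[j /= jn] _.
have -> : forall c (X : A) m, l1_cst c * (X *+ m) = l1_cst (c * m%:R) * X.
  move=> c X m; rewrite -[X *+ m]mulr_natl rmorphM /=.
  by rewrite (rmorph_nat (l1_cst : {rmorphism R -> A})) mulrA.
rewrite [RHS](_ : _ = l1_cst (j`!%:R^-1 * (n - j)`!%:R^-1) * (a ^+ (n - j) * b ^+ j)).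
  apply: (congr1 (fun c => l1_cst c * _)).
rewrite ltnS in jn.
have nz k : (k`!%:R : R) != 0 by rewrite pnatr_eq0 -lt0n fact_gt0.
have := bin_fact jn => /(congr1 (fun m => m%:R : R)); rewrite !natrM => <-.
have := nz j; have := nz (n - j)%N; set x := _%:R; set y := (j`!)%:R => x0 y0.
have : ('C(n, j)%:R : R) != 0 by rewrite pnatr_eq0 -lt0n bin_gt0.
  by set z := _%:R => z0; field; rewrite x0 y0.
by rewrite rmorphM /=; ring.
Qed.

Lemma l1_expD a b : l1_exp (a + b) = l1_exp a * l1_exp b.
Proof.
have sa := l1_exp_summable a; have sb := l1_exp_summable b.
rewrite [X in _ = _ * X](erefl : l1_exp b = l1_sum (l1_exp_term b)) (l1_mul_sum _ sb).
rewrite (eq_l1_sum (g := fun j => l1_sum (fun i => l1_exp_term b j * l1_exp_term a i))); last first.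
  by move=> j; rewrite mulrC (l1_mul_sum _ sa).
have sji j : abs_summable (fun i => N (l1_exp_term b j * l1_exp_term a i)).
  exact: l1_norm_summableM.
have ss : abs_summable (fun j => N (l1_sum (fun i => l1_exp_term b j * l1_exp_term a i))).
  apply: le_abs_summable (abs_summableZ (N (l1_exp a)) sb) => j.
  rewrite ger0_norm ?l1_norm_ge0// ger0_norm; last by rewrite mulr_ge0 ?l1_norm_ge0.
  by rewrite -(l1_mul_sum _ sa) mulrC; exact: l1_normM.
apply: l1P => x; rewrite l1_expE (l1_sumE x ss).
pose h j i := (l1_exp_term b j * l1_exp_term a i) x.
have hs j : abs_summable (h j) by exact: (l1_sum_row x (sji j)).
(* Cauchy product: row [j] is delayed by [j], so that column [n] collects the products with indices
   adding up to [n], which is the binomial expansion of the [n]-th term. *)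
pose k j n := if (j <= n)%N then h j (n - j)%N else 0.
have ks : abs_summable2 k.
  rewrite /abs_summable2; under eq_esum => j _.
    rewrite (_ : abs_sum (k j) = abs_sum (h j)); first over.
    have [dls dl] := rsum_delay j (abs_summable_norm (hs j)).
    rewrite -[RHS]rsum_norm// -dl rsum_nnegE//; last by move=> n; case: ifP.
    by apply: eq_esum => n _; rewrite /k; case: ifP; rewrite ?normr0.
  apply: le_lt_trans (abs_summableZ (rsum (fun i => N (l1_exp_term a i))) sb).
  apply: le_esum => j _; rewrite ger0_norm; last first.
    by rewrite mulr_ge0 ?l1_norm_ge0//; apply: rsum_ge0 => i; exact: l1_norm_ge0.
  rewrite -rsum_norm// lee_fin -(mulrC (N _)) -rsumZ//; apply: le_rsum.
  - exact: abs_summable_norm.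
  - exact: abs_summableZ.
  - by move=> i; apply: (le_trans (l1_abs_le _ _)); exact: l1_normM.
transitivity (rsum (fun j => rsum (k j))); last first.
  apply: eq_rsum => j; rewrite (l1_sumE x (sji j)).
  by have [_ ->] := rsum_delay j (hs j).
rewrite rsum_exchange//; apply: eq_rsum => n.
by rewrite l1_exp_termD l1_bigE -(rsum_truncate (fun j => h j (n - j)%N)).
Qed.

Lemma l1_exp0 : l1_exp 0 = 1.
Proof. by rewrite -(rmorph0 (@l1_cst R V)) l1_exp_cst expR0 rmorph1. Qed.

Lemma l1_expMn a n : l1_exp a ^+ n = l1_exp (l1_cst n%:R * a).
Proof.
elim: n => [|n IH]; first by rewrite expr0 rmorph0 mul0r l1_exp0.
rewrite -nat1r rmorphD rmorph1 mulrDl mul1r l1_expD exprS.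
by rewrite IH.
Qed.

(** The remainder is the series of [a^n / (n+4)!], dominated termwise by the exponential series
    because [n! <= (n+4)!]. *)
Lemma l1_exp_tail4 a : exists2 r : A, N r <= expR (N a) &
  l1_exp a = 1 + a + l1_cst 2^-1 * a ^+ 2 + l1_cst 6^-1 * a ^+ 3 + a ^+ 4 * r.
Proof.
pose f n := l1_cst (n.+4)`!%:R^-1 * a ^+ n.
have fle n : N (f n) <= exp_coeff (N a) n.
  rewrite l1_normZ /exp_coeff /= mulrC ger0_norm ?invr_ge0//.
  apply: ler_pM => //; rewrite ?l1_normX ?l1_norm_ge0// ?invr_ge0//.
  rewrite lef_pV2 ?posrE ?ltr0n ?fact_gt0// ler_nat.
  by rewrite leq_fact// -addn4 leq_addr.
have fs : abs_summable (fun n => N (f n)).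
  apply: le_abs_summable (proj1 (exp_coeff_summable (N a))) => n.
  rewrite !ger0_norm ?l1_norm_ge0//.
  by rewrite exp_coeff_ge0 ?l1_norm_ge0.
exists (l1_sum f).
  rewrite (le_trans (l1_norm_l1_sum fs))//.
  have [es <-] := exp_coeff_summable (N a); exact: le_rsum.
have s0 := l1_exp_summable a; have s1 := abs_summableS s0.
have s2 := abs_summableS s1; have s3 := abs_summableS s2.
rewrite /l1_exp (l1_sumS s0) (l1_sumS s1) (l1_sumS s2) (l1_sumS s3) l1_mul_sum//.
rewrite (eq_l1_sum (g := fun n => a ^+ 4 * f n)); last first.
  by move=> n; rewrite /l1_exp_term /f [RHS]mulrCA -exprD add4n.
rewrite /l1_exp_term /=; have -> : 3`! = 6%N by [].
have -> : 2`! = 2%N by []. have -> : 1`! = 1%N by []. have -> : 0`! = 1%N by [].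
by rewrite expr0 expr1 !addrA mulr1 invr1 rmorph1 mul1r.
Qed.

End l1_exp.

(** * Smoothing *)

Section smoothing.
Context {R : realType} {V : zmodType}.
Local Notation A := (l1 R V).
Local Notation N := (@l1_norm R V).
Local Notation "c %:A" := (@l1_cst R V c) : ring_scope.

(** Take [s = t]. This is Cauchy-Schwarz in linearised form: a sum is bounded term by term with a
    free parameter [s], and the parameter is optimised only at the end. *)
Lemma amgm_sqr (t W : R) : 0 <= t -> 0 <= W ->
  (forall s, 0 < s -> t <= (s + W / s) / 2) -> t ^+ 2 <= W.
Proof.
move=> t0 W0 h; have [->|tn0] := eqVneq t 0; first by rewrite expr0n.
have tp : 0 < t by rewrite lt_neqAle eq_sym tn0.
have := h t tp; rewrite -(ler_pM2r tp).
rewrite (_ : (t + W / t) / 2 * t = (t ^+ 2 + W) / 2); last by field.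
by rewrite expr2; lra.
Qed.

Section list_argument.
Variables (al be b : R) (X B : A).
Hypotheses (al0 : 0 <= al) (be0 : 0 <= be) (NX : N X <= 1) (NB : N B <= b).
Hypothesis total : al + be + b <= 1.
Let F := al%:A + be%:A * X + B.

Let stepN (c : R) (e : nat -> R) k := if k is k'.+1 then e k + c * e k' else e 0%N.

Let steps (i : A * (nat -> R)) : seq (A * (nat -> R)) :=
  [:: (al%:A * i.1, stepN (- be) i.2);
      (be%:A * X * i.1, stepN al i.2); (B * i.1, i.2)].

(* Each of M factors of F^M contributes a centred statistic worth -be on the
   term al, al on the term be X and 0 on B; i.2 k is the k-th elementary
   symmetric function of these statistics. *)
Lemma smoothing_list M : exists s : seq (A * (nat -> R)),
  [/\ forall k, \sum_(i <- s) (i.2 k)%:A * i.1 =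
        ((al * be) ^+ k * 'C(M, k)%:R)%:A * ((X - 1) ^+ k * F ^+ (M - k)),
      \sum_(i <- s) N i.1 <= 1 &
      forall k, \sum_(i <- s) N i.1 * i.2 k ^+ 2 <=
        'C(M, k)%:R * (al * be * (al + be)) ^+ k].
Proof.
have b0 : 0 <= b := le_trans (l1_norm_ge0 B) NB.
elim: M => [|M [s [sE s1 s2]]].
  exists [:: (1, fun k => (k == 0%N)%:R)]; split.
  - move=> k; rewrite big_seq1 /= mulr1; case: k => [|k] /=.
      by rewrite !(expr0, bin0, mulr1, rmorph1, mul1r).
    by rewrite bin0n mulr0 rmorph0 mul0r.
  - by rewrite big_seq1 l1_norm1.
  - move=> k; rewrite big_seq1 l1_norm1 mul1r; case: k => [|k] /=.
      by rewrite expr1n bin0 expr0 mulr1.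
    by rewrite bin0n mul0r expr0n.
exists (flatten [seq steps i | i <- s]).
have sumE (T : nmodType) (f : A * (nat -> R) -> T) :
    \sum_(i <- flatten [seq steps i | i <- s]) f i =
    \sum_(i <- s) (f (al%:A * i.1, stepN (- be) i.2) +
      (f (be%:A * X * i.1, stepN al i.2) + f (B * i.1, i.2))).
  rewrite big_flatten big_map; apply: eq_bigr => i _.
  by rewrite /steps !big_cons big_nil /= addr0.
have N1 (a : A) : N (al%:A * a) <= al * N a by rewrite l1_normZ ger0_norm.
have N2 (a : A) : N (be%:A * X * a) <= be * N a.
  rewrite -mulrA l1_normZ ger0_norm// ler_wpM2l// (le_trans (l1_normM _ _))//.
  by rewrite ler_piMl// l1_norm_ge0.
have N3 (a : A) : N (B * a) <= b * N a.
  by rewrite (le_trans (l1_normM _ _))// ler_wpM2r// l1_norm_ge0.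
split.
- case=> [|k]; rewrite sumE /=.
    have := sE 0%N; rewrite !(expr0, bin0, subn0, mul1r, rmorph1) => sE0.
    rewrite exprS -sE0 mulr_sumr; apply: eq_bigr => i _ /=.
    by rewrite /F; ring.
  (* A new factor either leaves the statistic of order [k+1] unchanged, which multiplies by [F], or
     enters it with its own value, which multiplies by [- be * al + al * be * X = al * be * (X -
     1)]. *)
  transitivity (F * (\sum_(i <- s) (i.2 k.+1)%:A * i.1)
      + (al * be)%:A * (X - 1) * (\sum_(i <- s) (i.2 k)%:A * i.1)).
    rewrite !mulr_sumr -big_split; apply: eq_bigr => i _ /=.
    by rewrite !rmorphD !rmorphM !rmorphN /F; ring.
  have dist c x y (Q : A) : (c * (x + y))%:A * Q = (c * x)%:A * Q + (c * y)%:A * Q.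
    by rewrite mulrDr rmorphD mulrDl.
  rewrite !sE subSS binS natrD dist; congr (_ + _).
    have [kM|Mk] := ltnP k M; last by rewrite bin_small// mulr0 rmorph0 !mul0r mulr0.
    by rewrite -[in RHS](subnSK kM) [F ^+ _.+1]exprS mulrCA; congr (_ * _); rewrite mulrCA.
  rewrite !exprS; set P := (X - 1) ^+ k; set Q := F ^+ _; set c := (al * be) ^+ k.
  by rewrite !rmorphM; ring.
- rewrite sumE; apply: le_trans s1; apply: ler_sum => i _ /=.
  apply: (@le_trans _ _ (al * N i.1 + (be * N i.1 + b * N i.1))).
    by rewrite !lerD.
  by rewrite -!mulrDl ler_piMl ?l1_norm_ge0// addrA.
- move=> k; rewrite sumE /=.
  apply: (@le_trans _ _ (\sum_(i <- s) (al * N i.1 * stepN (- be) i.2 k ^+ 2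
      + (be * N i.1 * stepN al i.2 k ^+ 2 + b * N i.1 * i.2 k ^+ 2)))).
    apply: ler_sum => i _; rewrite !lerD// ler_wpM2r ?sqr_ge0//.
  case: k => [|k] /=.
    have := s2 0%N; rewrite !(bin0, expr0) => s20; apply: le_trans s20.
    apply: ler_sum => i _.
    by rewrite -!mulrDl ler_wpM2r ?sqr_ge0// ler_piMl ?l1_norm_ge0// addrA.
  (* The cross terms cancel because the statistic is centred, [al * (- be) + be * al = 0]; its
     second moment is [al * be^2 + be * al^2 = al * be * (al + be)]. *)
  apply: (@le_trans _ _ (\sum_(i <- s) N i.1 * i.2 k.+1 ^+ 2
     + (al * be * (al + be)) * \sum_(i <- s) N i.1 * i.2 k ^+ 2)).
    rewrite mulr_sumr -big_split; apply: ler_sum => i _ /=.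
    rewrite -subr_ge0.
    rewrite (_ : _ - _ = (1 - (al + be + b)) * (N i.1 * i.2 k.+1 ^+ 2)); last by ring.
    by rewrite mulr_ge0 ?subr_ge0// mulr_ge0 ?sqr_ge0 ?l1_norm_ge0.
  rewrite binS natrD mulrDl lerD ?s2//.
  rewrite exprS mulrCA ler_wpM2l ?s2// !mulr_ge0// addr_ge0//.
Qed.

(** The expansion of [M + k] factors, weighted at level [k], leaves exactly [F ^+ M]. The bound is
    kept free of division so that it also covers [al * be = 0]. *)
Lemma smoothing M k :
  N ((X - 1) ^+ k * F ^+ M) ^+ 2 * ('C(M + k, k)%:R * (al * be) ^+ k)
    <= (al + be) ^+ k.
Proof.
have [s [sE s1 s2]] := smoothing_list (M + k).
have := sE k; rewrite addnK => {}sE.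
set c := 'C(M + k, k)%:R; set t := N _.
have c0 : 0 < c :> R by rewrite ltr0n bin_gt0 leq_addl.
have ab0 : 0 <= al * be by rewrite mulr_ge0.
have ab1 : 0 <= al + be by rewrite addr_ge0.
have d0 : 0 <= c * (al * be) ^+ k by rewrite mulr_ge0 ?(ltW c0) ?exprn_ge0.
have [d1|dn0] := eqVneq (c * (al * be) ^+ k) 0.
  by rewrite d1 mulr0 exprn_ge0.
have dp : 0 < c * (al * be) ^+ k by rewrite lt_neqAle eq_sym dn0.
have W : (c * (al * be) ^+ k * t) ^+ 2 <= c * (al * be * (al + be)) ^+ k.
  apply: amgm_sqr.
  - by rewrite mulr_ge0// l1_norm_ge0.
  - by rewrite mulr_ge0 ?(ltW c0)// exprn_ge0// mulr_ge0.
  move=> z z0.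
  have -> : c * (al * be) ^+ k * t = N (\sum_(i <- s) (i.2 k)%:A * i.1).
    by rewrite sE l1_normZ (mulrC c) ger0_norm// mulrC.
  apply: (le_trans (l1_norm_sum _ _ _)).
  apply: (@le_trans _ _ (\sum_(i <- s) (z * N i.1 + N i.1 * i.2 k ^+ 2 / z) / 2)).
    apply: ler_sum => i _; rewrite l1_normZ -subr_ge0.
    rewrite (_ : _ - _ = N i.1 / (2 * z) * (`|i.2 k| - z) ^+ 2).
      rewrite mulr_ge0 ?sqr_ge0// divr_ge0 ?l1_norm_ge0//.
      by rewrite mulr_ge0// ltW.
    rewrite sqrrB real_normK ?num_real//; field.
    by rewrite gt_eqF.
  rewrite -mulr_suml big_split /= -mulr_sumr -mulr_suml ler_wpM2r// lerD//.
    by rewrite ler_piMr// ltW.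
  by rewrite ler_wpM2r ?s2// invr_ge0 ltW.
rewrite -(ler_pM2r dp); apply: le_trans (le_trans W _).
  by rewrite le_eqVlt; apply/orP; left; apply/eqP; ring.
by rewrite exprMn le_eqVlt; apply/orP; left; apply/eqP; ring.
Qed.

End list_argument.

(** * Transfer of smoothing from powers to exponentials by Poisson mixing *)

Definition poisson (lam : R) (j : nat) : R := expR (- lam) * exp_coeff lam j.

Lemma poisson_ge0 lam j : 0 <= lam -> 0 <= poisson lam j.
Proof. by move=> l0; rewrite mulr_ge0 ?expR_ge0 ?exp_coeff_ge0. Qed.

Lemma poisson_sum lam : 0 <= lam ->
  abs_summable (poisson lam) /\ rsum (poisson lam) = 1.
Proof.
move=> l0; have [es e] := exp_coeff_summable lam.
by split; [exact: abs_summableZ|rewrite rsumZ// e mulrC expRxMexpNx_1].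
Qed.

Lemma norm_exp_poisson (F : A) (lam : R) : N F <= 1 -> 0 <= lam -> forall v : A,
  abs_summable (fun j => poisson lam j * N (v * F ^+ j)) /\
  N (v * l1_exp (lam%:A * (F - 1))) <= rsum (fun j => poisson lam j * N (v * F ^+ j)).
Proof.
move=> NF l0 v; have [ps _] := poisson_sum l0.
have Fj j : N (F ^+ j) <= 1 by rewrite (le_trans (l1_normX _ _))// exprn_ile1// l1_norm_ge0.
have sF : abs_summable (fun j => N ((poisson lam j)%:A * F ^+ j)).
  apply: le_abs_summable (ps) => j; rewrite l1_normZ normrM normr_id.
  by rewrite ler_piMr// ger0_norm ?l1_norm_ge0.
have svF : abs_summable (fun j => N (v * ((poisson lam j)%:A * F ^+ j))).
  exact: l1_norm_summableM.
have E : (fun j => N (v * ((poisson lam j)%:A * F ^+ j))) =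
         (fun j => poisson lam j * N (v * F ^+ j)).
  by apply/funext => j; rewrite mulrCA l1_normZ ger0_norm// poisson_ge0.
rewrite -E; split=> //.
suff -> : l1_exp (lam%:A * (F - 1)) = l1_sum (fun j => (poisson lam j)%:A * F ^+ j).
  by rewrite (l1_mul_sum _ sF); exact: l1_norm_l1_sum.
rewrite mulrBr mulr1 -rmorphN addrC l1_expD l1_exp_cst.
rewrite (l1_mul_sum _ (l1_exp_summable _)); apply: eq_l1_sum => j.
by rewrite /l1_exp_term exprMn -rmorphXn /poisson /exp_coeff /= !rmorphM; ring.
Qed.

(** The binomial weight fits the Poisson law: [poisson lam j / 'C(j + k, k) = k! lam^-k poisson lam
    (j + k)], and the shifted weights still sum to at most 1. Averaging the squared bounds thus
    costs only [k! / (K lam^k)]. *)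
Lemma poisson_smoothing (F v : A) (lam K : R) k : N F <= 1 -> 0 < lam -> 0 < K ->
  (forall j, N (v * F ^+ j) ^+ 2 * ('C(j + k, k)%:R * K) <= 1) ->
  N (v * l1_exp (lam%:A * (F - 1))) ^+ 2 * (K * lam ^+ k) <= k`!%:R.
Proof.
move=> NF l0 K0 h.
have [vs vle] := norm_exp_poisson NF (ltW l0) v.
have [ps p1] := poisson_sum (ltW l0).
have Kl : 0 < K * lam ^+ k by rewrite mulr_gt0 ?exprn_gt0.
rewrite -ler_pdivlMr//; set W := _ / _.
have W0 : 0 <= W by rewrite divr_ge0// ltW.
apply: amgm_sqr => // [|s s0]; first exact: l1_norm_ge0.
have [sm sme] : abs_summable (fun j => poisson lam (j + k))
    /\ rsum (fun j => poisson lam (j + k)) <= 1.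
  rewrite -p1; elim: k {h Kl W W0} => [|k [IHs IH]].
    have -> : (fun j => poisson lam (j + 0)) = poisson lam.
      by apply/funext => j; rewrite addn0.
    by split.
  have -> : (fun j => poisson lam (j + k.+1)) = (fun j => poisson lam (j.+1 + k)).
    by apply/funext => j; rewrite addnS.
  split; first exact: abs_summableS IHs.
  apply: le_trans IH; rewrite [leRHS](rsumS IHs).
  by rewrite lerDr poisson_ge0// ltW.
apply: (le_trans vle).
have -> : (s + W / s) / 2 = s / 2 * 1 + W / s / 2 * 1 by ring.
apply: (@le_trans _ _ (s / 2 * rsum (poisson lam)
     + W / s / 2 * rsum (fun j => poisson lam (j + k)))).
  rewrite -!rsumZ// -rsumD; [|exact: abs_summableZ|exact: abs_summableZ].
  apply: le_rsum => //; first by apply: abs_summableD; exact: abs_summableZ.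
  move=> j; set t := N _.
  have pj : 0 <= poisson lam j by rewrite poisson_ge0// ltW.
  have := h j; rewrite -/t => hj.
  have Ck : 0 < ('C(j + k, k)%:R : R) by rewrite ltr0n bin_gt0 leq_addl.
  have -> : W / s / 2 * poisson lam (j + k) =
      poisson lam j * ((K * 'C(j + k, k)%:R)^-1 / s / 2).
    rewrite /W /poisson /exp_coeff /= exprD.
    have := bin_fact (leq_addl j k); rewrite addnK => /(congr1 (fun m => m%:R : R)).
    rewrite !natrM => <-.
    have nz m : (m`!%:R : R) != 0 by rewrite pnatr_eq0 -lt0n fact_gt0.
    by field; rewrite !nz !gt_eqF ?exprn_gt0.
  rewrite [s / 2 * _]mulrC -mulrDr ler_wpM2l//.
  have : t ^+ 2 <= (K * 'C(j + k, k)%:R)^-1.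
    by rewrite -div1r ler_pdivlMr ?mulr_gt0// (mulrC K).
  set w := _^-1 => tw.
  apply: (@le_trans _ _ (s / 2 + t ^+ 2 / s / 2)).
    rewrite -subr_ge0 (_ : _ - _ = (s - t) ^+ 2 / (2 * s)); last first.
      by field; rewrite gt_eqF.
    by rewrite divr_ge0 ?sqr_ge0// mulr_ge0// ltW.
  by rewrite lerD2l !ler_wpM2r ?invr_ge0// ltW.
by rewrite lerD// ler_wpM2l// ?p1// !divr_ge0// ltW.
Qed.

End smoothing.

(** * Smoothing estimates for probability laws with an atom at zero *)

Section law.
Context {R : realType} {V : zmodType}.
Local Notation A := (l1 R V).
Local Notation N := (@l1_norm R V).
Local Notation "c %:A" := (@l1_cst R V c) : ring_scope.
Local Notation pt x := (@l1_pt R V x 1).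

Definition is_law (F : A) (q : R) : Prop :=
  [/\ forall x, 0 <= F x, rsum F = 1 & F 0 = q].

(** For [z = 1/y] this is [delta(y) / y], the form in which [delta] arises from bounding each atom
    separately. *)
Definition min_sum (F : A) (z : R) : R :=
  rsum (fun x => if x == 0 then 0 else Num.min (4 * F x) z).

Lemma l1_norm_nneg (a : A) : (forall x, 0 <= a x) -> N a = rsum a.
Proof. by move=> a0; apply: eq_rsum => x; rewrite ger0_norm. Qed.

Lemma l1_norm_sub (a c : A) : (forall x, 0 <= c x <= a x) ->
  N (a - c) = N a - N c.
Proof.
move=> ca; have [c0 a0 le] : [/\ forall x, 0 <= c x, forall x, 0 <= a x
    & forall x, c x <= a x].
  by split=> x; have /andP[h1 h2] := ca x => //; exact: le_trans h1 h2.
rewrite !l1_norm_nneg//; last first.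
  by move=> x; rewrite l1_addE l1_oppE subr_ge0.
rewrite -rsumN -rsumD//; first exact: l1_summable.
by apply: abs_summableN; exact: l1_summable.
Qed.

Lemma l1_cstX c k : c%:A ^+ k = (c ^+ k)%:A.
Proof. by rewrite rmorphXn. Qed.

Lemma l1_cstMr c d : c%:A * d%:A = (c * d)%:A.
Proof. by rewrite rmorphM. Qed.

Lemma l1_pt0 : pt 0 = 1. Proof. by []. Qed.

Lemma l1_ptD x y c d : l1_pt x c * l1_pt y d = l1_pt (x + y) (c * d) :> A.
Proof.
apply: l1P => z; rewrite l1_ptM !l1_ptE subr_eq (addrC y).
by case: eqP; rewrite ?mulr0.
Qed.

Section one_law.
Variables (F : A) (q : R).
Hypotheses (FL : is_law F q) (q0 : 0 < q) (q1 : q < 1).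
Let p := 1 - q.
Let u := F - 1.

Lemma law_norm : N F = 1.
Proof. by have [F0 F1 _] := FL; rewrite l1_norm_nneg. Qed.

Lemma law_normX n : N (F ^+ n) <= 1.
Proof. by rewrite (le_trans (l1_normX _ _))// law_norm expr1n. Qed.

Lemma law_p_gt0 : 0 < p. Proof. by rewrite subr_gt0. Qed.

Lemma law_rest : N (F - q%:A) = p.
Proof.
have [F0 F1 Fq] := FL.
rewrite l1_norm_sub ?law_norm ?l1_norm_cst ?gtr0_norm// => x.
by rewrite l1_cstE; case: eqP => [->|_]; rewrite ?lexx ?F0// Fq (ltW q0) lexx.
Qed.

(** Here [al = q], [be = p] and [B = 0], so [al + be = 1]. Since [u = p (G - 1)], a factor [p^(2k)]
    meets [(q p)^k], and the surplus [p^k] appears on the right. *)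
Lemma law_smoothing k M :
  N (u ^+ k * F ^+ M) ^+ 2 * ('C(M + k, k)%:R * q ^+ k) <= p ^+ k.
Proof.
have p0 := law_p_gt0; pose G := (p^-1)%:A * (F - q%:A).
have pG : p%:A * G = F - q%:A.
  by rewrite mulrA l1_cstMr mulfV ?gt_eqF// rmorph1 mul1r.
have NG : N G <= 1.
  by rewrite l1_normZ law_rest gtr0_norm ?invr_gt0// mulVf ?gt_eqF.
have FE : q%:A + p%:A * G + 0 = F by rewrite pG addr0 addrC subrK.
have uE : u = p%:A * (G - 1).
  by rewrite mulrBr pG mulr1 /u -[p%:A]/((1 - q)%:A) rmorphB rmorph1; ring.
have := @smoothing R V q p 0 G 0 (ltW q0) (ltW p0) NG _ _ M k.
rewrite l1_norm0 FE addr0 lexx (_ : q + p = 1); last by rewrite addrC subrK.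
rewrite lexx => /(_ isT isT); rewrite expr1n.
move=> h1; rewrite uE exprMn l1_cstX -[_%:A * _ * _]mulrA l1_normZ ger0_norm ?exprn_ge0 ?(ltW p0)//.
move: h1; set t := N _; set c := 'C(_, _)%:R => h.
rewrite (_ : _ * (c * q ^+ k) = p ^+ k * (t ^+ 2 * (c * (q * p) ^+ k))).
  by rewrite ler_piMr// exprn_ge0// ltW.
by rewrite (exprMn k q p); set d := p ^+ k; set g := q ^+ k; ring.
Qed.

Lemma law_smoothing_pt x M : x != 0 ->
  N ((pt x - 1) * F ^+ M) ^+ 2 * (M.+1%:R * (q * F x)) <= 1.
Proof.
move=> x0; have [F0 F1 Fq] := FL.
(* Only the atoms at 0 and at [x] are resolved; the rest [F - c] is nonnegative, of mass
   [1 - q - F x], and plays the part of [B]. *)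
pose c : A := q%:A + l1_pt x (F x).
have cE y : c y = if y == 0 then q else if y == x then F x else 0.
  rewrite l1_addE l1_cstE l1_ptE; case: eqP => [->|_]; last by rewrite add0r.
  by rewrite eq_sym (negbTE x0) addr0.
have cF y : 0 <= c y <= F y.
  rewrite cE; case: eqP => [->|_]; first by rewrite Fq (ltW q0) lexx.
  by case: eqP => [->|_]; rewrite ?F0 ?lexx.
have NF : N (F - c) = 1 - N c by rewrite l1_norm_sub// law_norm.
have Nc : N c = q + F x.
  rewrite l1_norm_nneg => [|y]; last by have /andP[] := cF y.
  transitivity (rsum (fun y => (q%:A : A) y + l1_pt x (F x) y)); first by [].
  rewrite rsumD; [|exact: l1_summable|exact: l1_summable].
  rewrite -!l1_norm_nneg ?l1_norm_pt ?ger0_norm// ?(ltW q0)// => y.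
    by rewrite l1_ptE; case: eqP.
  by rewrite l1_ptE; case: eqP => // _; exact: ltW.
have FE : q%:A + (F x)%:A * pt x + (F - c) = F.
  by rewrite [(F x)%:A * _]l1_ptD add0r mulr1 -/c addrC subrK.
have tot : q + F x + (1 - (q + F x)) = 1 by ring.
have := @smoothing R V q (F x) (1 - (q + F x)) (pt x) (F - c) (ltW q0) (F0 x) _ _ _ M 1.
rewrite l1_norm_pt normr1 lexx NF Nc lexx tot lexx FE => /(_ isT isT isT).
rewrite addn1 bin1 !expr1 => h; apply: le_trans h _.
by rewrite -subr_ge0 -Nc -NF l1_norm_ge0.
Qed.

(** Laziness pushes the atom at 0 towards 1, while in an exponential it is compensated by running
    the time faster by [1/e]. So exponentials smooth better than the atom [q] of [F] itself would
    give. *)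
Lemma law_lazy (e : R) : 0 < e <= 1 -> is_law (1 + e%:A * u) (1 - e * p).
Proof.
move=> /andP[e0 e1]; have [F0 F1 Fq] := FL.
have E : 1 + e%:A * u = (1 - e)%:A + e%:A * F.
  by rewrite /u rmorphB rmorph1; ring.
split.
- move=> x; rewrite E l1_addE l1_cstM l1_cstE addr_ge0//.
    by case: eqP => // _; rewrite subr_ge0.
  by rewrite mulr_ge0// ltW.
- rewrite E; transitivity (rsum (fun x => (1 - e)%:A x + e * F x)).
    by apply: eq_rsum => x; rewrite l1_addE l1_cstM.
  rewrite rsumD; [|exact: l1_summable|exact/abs_summableZ/l1_summable].
  rewrite rsumZ ?F1; last exact: l1_summable.
  rewrite -l1_norm_nneg ?l1_norm_cst ?ger0_norm ?subr_ge0//; first by ring.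
  by move=> x; rewrite l1_cstE; case: eqP => // _; rewrite subr_ge0.
- by rewrite E l1_addE l1_cstM l1_cstE eqxx Fq /p; ring.
Qed.

End one_law.

Section exp_smoothing.
Variables (F : A) (q : R).
Hypotheses (FL : is_law F q) (q0 : 0 < q) (q1 : q < 1).
Let p := 1 - q.
Let u := F - 1.

Lemma lazy_bounds e : 0 < e <= 1 -> 0 < 1 - e * p < 1.
Proof.
move=> /andP[e0 e1]; have p0 : 0 < p by rewrite subr_gt0.
have : e * p <= p by rewrite ler_piMl// ltW.
have : 0 < e * p by rewrite mulr_gt0.
have : p < 1 by rewrite gtrBl.
by move: (e * p) => t ? ? ?; lra.
Qed.

Lemma exp_lazy e y : e != 0 ->
  l1_exp (y%:A * u) = l1_exp ((y / e)%:A * ((1 + e%:A * u) - 1)).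
Proof.
move=> e0; congr l1_exp; rewrite addrAC subrr add0r mulrA l1_cstMr.
by rewrite divfK.
Qed.

(** The gain per power of [u] is [(1 - e p) y / p], against [q y / p] for [e = 1]. The parameter
    stays free because controlling the powers of [D] requires a small [e]. *)
Lemma law_exp_smoothing e y k : 0 < e <= 1 -> 0 < y ->
  N (u ^+ k * l1_exp (y%:A * u)) ^+ 2 * ((1 - e * p) * y / p) ^+ k <= k`!%:R.
Proof.
move=> eb y0; have /andP[qe0 qe1] := lazy_bounds eb; have /andP[e0 e1] := eb.
have p0 : 0 < p by rewrite subr_gt0.
have L := law_lazy FL eb.
rewrite (exp_lazy _ (lt0r_neq0 e0)).
have Kp : 0 < (e * (1 - e * p) / p) ^+ k by rewrite exprn_gt0// divr_gt0// mulr_gt0.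
have NF : N (1 + e%:A * u) <= 1 by rewrite (law_norm L).
have ye : 0 < y / e by rewrite divr_gt0.
have := @poisson_smoothing R V _ (u ^+ k) _ _ k NF ye Kp.
rewrite -exprMn (_ : e * _ / p * (y / e) = (1 - e * p) * y / p); last first.
  by field; rewrite !gt_eqF.
apply=> j; have := law_smoothing L qe0 qe1 k j.
rewrite (_ : 1 + e%:A * u - 1 = e%:A * u); last by rewrite addrAC subrr add0r.
rewrite exprMn l1_cstX -[_%:A * _ * _]mulrA l1_normZ ger0_norm ?exprn_ge0 ?(ltW e0)//.
rewrite (_ : 1 - (1 - e * p) = e * p); last by ring.
set t := N _; set c := 'C(_, _)%:R => h.
have ep : 0 < (e * p) ^+ k by rewrite exprn_gt0// mulr_gt0.
rewrite -(ler_pM2l ep) mulr1; apply: le_trans h.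
rewrite le_eqVlt; apply/orP; left; apply/eqP.
rewrite !exprMn exprVn; set a := e ^+ k; set b := _ ^+ k; set d := p ^+ k.
have d0 : d != 0 by rewrite expf_neq0// gt_eqF.
by field.
Qed.

Lemma law_exp_smoothing_pt y x : 0 < y -> x != 0 ->
  N ((pt x - 1) * l1_exp (y%:A * u)) ^+ 2 * (F x * y) <= 2.
Proof.
(* With [e = 1/2] the lazy law has atom [1 - e p >= 1/2] at 0 and mass [F x / 2] at [x], and the
   time becomes [2 y]; together this gives the constant 2. *)
move=> y0 x0; pose e : R := 2^-1.
have eb : 0 < e <= 1 by rewrite /e; lra.
have /andP[e0 e1] := eb.
have /andP[qe0 qe1] := lazy_bounds eb; have L := law_lazy FL eb.
have [F0 _ _] := FL.
have [->|Fx] := eqVneq (F x) 0; first by rewrite mul0r mulr0.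
have Fx0 : 0 < F x by rewrite lt_neqAle eq_sym Fx F0.
rewrite (exp_lazy _ (lt0r_neq0 e0)).
have Kp : 0 < (1 - e * p) * (e * F x) by rewrite !mulr_gt0.
have NF : N (1 + e%:A * u) <= 1 by rewrite (law_norm L).
have ye : 0 < y / e by rewrite divr_gt0.
have := @poisson_smoothing R V _ (pt x - 1) _ _ 1 NF ye Kp.
rewrite expr1 (_ : 1`!%:R = 1 :> R)// => h.
set t := N _ ^+ 2 in h *.
have t0 : 0 <= t by rewrite exprn_ge0// l1_norm_ge0.
have hh : t * ((1 - e * p) * (e * F x) * (y / e)) <= 1.
  apply: h => j; have := law_smoothing_pt L qe0 j x0.
  rewrite l1_addE l1_cstM /u l1_addE l1_oppE l1_oneE (negbTE x0) add0r subr0.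
  by rewrite addn1 bin1.
have ph : 2^-1 <= 1 - e * p.
  have : p < 1 by rewrite gtrBl.
  by rewrite /e; move: (p) => r r1; lra.
have : t * (2^-1 * (F x * y)) <= 1.
  apply: le_trans hh; rewrite ler_wpM2l//.
  rewrite (_ : _ * (y / e) = (1 - e * p) * (F x * y)); last by field; rewrite gt_eqF.
  by rewrite ler_wpM2r// mulr_ge0// ltW.
by rewrite mulrCA; lra.
Qed.

End exp_smoothing.

(** * Decomposition of [u] over the pairs of opposite points *)

Section coordinates.
Variables (F : A) (q : R).
Hypotheses (FL : is_law F q) (Fsym : forall x, F (- x) = F x).
Let u := F - 1.

Lemma min_sum_summable z : 0 <= z ->
  abs_summable (fun x => if x == 0 then 0 else Num.min (4 * F x) z).
Proof.
move=> z0; have [F0 _ _] := FL.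
apply: le_abs_summable (abs_summableZ 4 (l1_summable F)) => x.
rewrite [leRHS]ger0_norm ?mulr_ge0//; case: eqP => _; first by rewrite normr0 mulr_ge0.
by rewrite ger0_norm ?ge_min ?lexx// le_min mulr_ge0.
Qed.

Lemma min_sum_ge0 z : 0 <= z -> 0 <= min_sum F z.
Proof.
move=> z0; have [F0 _ _] := FL; apply: rsum_ge0 => x; case: eqP => // _.
by rewrite le_min mulr_ge0.
Qed.

Lemma min_sum_scale c z w : 1 <= c -> 0 <= z -> 0 <= w -> w <= c * z ->
  min_sum F w <= c * min_sum F z.
Proof.
move=> c1 z0 w0 wz; have [F0 _ _] := FL.
rewrite -rsumZ; last exact: min_sum_summable.
apply: le_rsum; [exact: min_sum_summable|exact/abs_summableZ/min_sum_summable|].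
move=> x; case: eqP => _; first by rewrite mulr0.
have := F0 x; have [h1|h1] := leP (4 * F x) w; have [h2|h2] := leP (4 * F x) z => Fx.
- by rewrite ler_peMl// mulr_ge0.
- exact: le_trans h1 wz.
- by rewrite (le_trans (ltW h1))// ler_peMl// mulr_ge0.
- exact: wz.
Qed.

Let coord x : A := (F x / 2)%:A * (pt x + pt (- x) - 2%:R).

(** The gain from symmetry: a second difference is a product of two first differences, and each
    takes its own half of the smoothing. A coordinate then decays like [1/M] instead of
    [1/sqrt M]. *)
Lemma coord_factor x :
  pt x + pt (- x) - 2%:R = - ((pt x - 1) * (pt (- x) - 1)) :> A.
Proof.
have : pt x * pt (- x) = 1 :> A by rewrite l1_ptD subrr mulr1.
by move=> h; rewrite mulrBl !mulrBr h; ring.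
Qed.

Lemma coord_norm x : N (coord x) <= 2 * F x.
Proof.
have [F0 _ _] := FL; rewrite /coord l1_normZ ger0_norm ?divr_ge0//.
rewrite coord_factor l1_normN.
have h v : N (pt v - 1) <= 2.
  by rewrite (le_trans (l1_normD _ _))// l1_normN l1_norm1 l1_norm_pt normr1.
have : N ((pt x - 1) * (pt (- x) - 1)) <= 2 * 2.
  by rewrite (le_trans (l1_normM _ _))// ler_pM ?l1_norm_ge0.
move=> h4; apply: (@le_trans _ _ (F x / 2 * (2 * 2))); first by rewrite ler_wpM2l ?divr_ge0.
by rewrite le_eqVlt; apply/orP; left; apply/eqP; field.
Qed.

Lemma coord_summable : abs_summable (fun x => N (coord x)).
Proof.
apply: le_abs_summable (abs_summableZ 2 (l1_summable F)) => x.
by rewrite ger0_norm ?l1_norm_ge0// (le_trans (coord_norm x))// ler_norm.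
Qed.

Lemma coord_sum : u = l1_sum coord.
Proof.
have [F0 F1 _] := FL.
apply: l1P => z; rewrite (l1_sumE z coord_summable).
pose f1 x := if x == z then F x / 2 else 0.
pose f2 x := if x == - z then F x / 2 else 0.
pose f3 x := - (if z == 0 then 1 else 0) * F x.
rewrite (eq_rsum (g := fun x => f1 x + f2 x + f3 x)); last first.
  move=> x; rewrite /coord l1_cstM !l1_addE l1_oppE l1_addE l1_oneE !l1_ptE.
  rewrite /f1 /f2 /f3 (eq_sym z x) (eq_sym z (- x)) eqr_oppLR.
  by case: eqP => _; case: eqP => _; case: eqP => _; field.
have s1 : abs_summable f1.
  apply: le_abs_summable (l1_summable (2^-1%:A * F)) => x; rewrite l1_cstM /f1.
  by case: eqP => _; rewrite ?normr0// mulrC.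
have s2 : abs_summable f2.
  apply: le_abs_summable (l1_summable (2^-1%:A * F)) => x; rewrite l1_cstM /f2.
  by case: eqP => _; rewrite ?normr0// mulrC.
have s3 : abs_summable f3 by exact/abs_summableZ/l1_summable.
rewrite rsumD//; last exact: abs_summableD.
rewrite rsumD// /f3 rsumZ ?F1; last exact: l1_summable.
rewrite (rsum_pt z (fun x => F x / 2)) (rsum_pt (- z) (fun x => F x / 2)).
by rewrite Fsym l1_addE l1_oppE l1_oneE; case: eqP => _; field.
Qed.

(** Each coordinate has the trivial bound [2 F x], half of [4 F x], and the smoothed bound [z / 2].
    Taking the smaller one for every [x] produces [min_sum]. *)
Lemma norm_by_coordinates (T : A) z : N T <= 1 -> 0 <= z ->
  (forall x, x != 0 -> F x * N ((pt x - 1) * (pt (- x) - 1) * T) <= z) ->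
  N (u * T) <= min_sum F z / 2.
Proof.
move=> NT z0 h; have [F0 _ _] := FL; have cs := coord_summable.
rewrite mulrC coord_sum (l1_mul_sum _ cs).
apply: (le_trans (l1_norm_l1_sum (l1_norm_summableM T cs))).
rewrite mulrC -rsumZ; last exact: min_sum_summable.
apply: le_rsum; [exact: l1_norm_summableM|exact/abs_summableZ/min_sum_summable|].
move=> x; case: eqP => [->|/eqP x0].
  by rewrite /coord oppr0 l1_pt0 (_ : 1 + 1 - 2%:R = 0) ?mulr0 ?l1_norm0//; ring.
have [h1|h1] := leP (4 * F x) z.
  rewrite (le_trans (l1_normM _ _))// (@le_trans _ _ (1 * N (coord x)))//.
    by rewrite ler_wpM2r// l1_norm_ge0.
  by rewrite mul1r (le_trans (coord_norm x))//; have := F0 x; lra.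
rewrite /coord mulrCA l1_normZ ger0_norm ?divr_ge0// coord_factor mulrN l1_normN.
have := h x x0; rewrite (mulrC T); set t := N _ => ht.
rewrite (_ : F x / 2 * t = 2^-1 * (F x * t)); last by ring.
by rewrite ler_wpM2l.
Qed.

Lemma norm_two_coordinates (a b c : R) (S T v w : A) : 0 <= a -> 0 <= b -> 0 < c ->
  N (v * S) ^+ 2 * (a * c) <= b -> N (w * T) ^+ 2 * (a * c) <= b ->
  a * N (v * w * (S * T)) <= b / c.
Proof.
move=> a0 b0 c0 h1 h2; rewrite ler_pdivlMr//.
apply: (@le_trans _ _ (N (v * S) * N (w * T) * (a * c))).
  rewrite mulrAC [leRHS]mulrC ler_wpM2l ?mulr_ge0 ?(ltW c0)// mulrACA.
  exact: l1_normM.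
set s := N (v * S) in h1 *; set t := N (w * T) in h2 *.
apply: (@le_trans _ _ ((s ^+ 2 * (a * c) + t ^+ 2 * (a * c)) / 2)); last by lra.
rewrite -subr_ge0 (_ : _ - _ = (s - t) ^+ 2 * (a * c) / 2); last by field.
by rewrite divr_ge0// mulr_ge0 ?sqr_ge0// mulr_ge0// ltW.
Qed.

Lemma law_pow_bound M z : 0 < q -> 1 <= z * (q * M.+1%:R) ->
  N (u * F ^+ (2 * M)) <= min_sum F z / 2.
Proof.
move=> q0 hz; have [F0 _ _] := FL.
have qM : 0 < q * M.+1%:R by rewrite mulr_gt0.
have z0 : 0 < z by rewrite -(pmulr_lgt0 _ qM) (lt_le_trans _ hz).
apply: norm_by_coordinates; [exact: law_normX FL _|exact: ltW|] => x x0.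
rewrite mul2n -addnn exprD; apply: le_trans (_ : 1 / (q * M.+1%:R) <= z); last first.
  by rewrite ler_pdivrMr.
apply: norm_two_coordinates => //.
  have := law_smoothing_pt FL q0 M x0.
  by rewrite (_ : _ * (q * F x) = F x * (q * M.+1%:R)) //; ring.
have nx0 : - x != 0 by rewrite oppr_eq0.
have := law_smoothing_pt FL q0 M nx0.
by rewrite Fsym (_ : _ * (q * F x) = F x * (q * M.+1%:R)) //; ring.
Qed.

Lemma law_exp_bound y z : 0 < q < 1 -> 0 < y -> 2 <= z * y ->
  N (u * l1_exp ((2 * y)%:A * u)) <= min_sum F z / 2.
Proof.
move=> /andP[q0 q1] y0 hz; have [F0 _ _] := FL.
have z0 : 0 < z by rewrite -(pmulr_lgt0 _ y0) (lt_le_trans _ hz).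
apply: norm_by_coordinates; [|exact: ltW|] => [|x x0].
  have NF : N F <= 1 by rewrite (law_norm FL).
  have l0 : 0 <= 2 * y by rewrite mulr_ge0// ltW.
  have [_] := norm_exp_poisson NF l0 1.
  rewrite mul1r => h; apply: le_trans h _.
  have [ps p1] := poisson_sum l0; rewrite -[leRHS]p1.
  apply: le_rsum => //.
    apply: le_abs_summable (ps) => j.
    rewrite [leLHS]normrM ler_piMr// mul1r ger0_norm ?l1_norm_ge0//.
    exact: law_normX FL j.
  by move=> j; rewrite mul1r ler_piMr ?(law_normX FL)// poisson_ge0.
have -> : 2 * y = y + y by ring.
rewrite rmorphD [(_ + _) * u]mulrDl l1_expD.
apply: le_trans (_ : 2 / y <= z); last by rewrite ler_pdivrMr.
apply: norm_two_coordinates => //; first exact: (law_exp_smoothing_pt FL q0 q1 y0 x0).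
have nx0 : - x != 0 by rewrite oppr_eq0.
by have := law_exp_smoothing_pt FL q0 q1 y0 nx0; rewrite Fsym.
Qed.

End coordinates.

End law.

(** * The approximation error *)

Section approximation.
Context {R : realType} {V : zmodType}.
Local Notation A := (l1 R V).
Local Notation N := (@l1_norm R V).
Local Notation "c %:A" := (@l1_cst R V c) : ring_scope.

(** In [F^(m+1) - D^(m+1) = (F - D) sum_k F^(m-k) D^k] every [D^k] is replaced by [F^k], and
    [F^k - D^k] is telescoped once more. The truncation in [m.-1] is harmless: for [m = 0] the inner
    sum is empty. *)
Lemma subrXX_order2 (T : comNzRingType) (F D : T) m :
  F ^+ m.+1 - D ^+ m.+1 = m.+1%:R * ((F - D) * F ^+ m)
    - (F - D) ^+ 2 * \sum_(k < m.+1) \sum_(j < k) F ^+ (m.-1 - j) * D ^+ j.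
Proof.
rewrite subrXX expr2 -[(F - D) * (F - D) * _]mulrA mulrCA -mulrBr; congr (_ * _).
have -> : m.+1%:R * F ^+ m = \sum_(k < m.+1) F ^+ m.
  by rewrite sumr_const card_ord mulr_natl.
rewrite mulr_sumr -sumrB.
apply: eq_bigr => -[k /= km] _.
have FDk : (F - D) * (\sum_(j < k) F ^+ (m.-1 - j) * D ^+ j)
    = F ^+ (m - k) * (F ^+ k - D ^+ k).
  rewrite subrXX mulrCA; congr (_ * _); rewrite mulr_sumr.
  apply: eq_bigr => -[j /= jk] _; rewrite mulrA -exprD; congr (F ^+ _ * _).
  rewrite ltnS in km; case: k => // k in km jk *.
  by case: m => // m in km *; rewrite subSS /= addnBA// subnK.
by rewrite FDk mulrBr -exprD subnK// subKr.
Qed.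

Lemma bin_2m_le m : ((2 * m)`!%:R : R) <= (4 ^+ m) * (m`!%:R) ^+ 2.
Proof.
elim: m => [|m IH]; first by rewrite muln0 fact0 expr1n mulr1.
rewrite mulnS add2n !factS !natrM mulrA.
apply: (@le_trans _ _ ((2 * m.+1)%:R * (2 * m.+1)%:R * (2 * m)`!%:R)).
  by rewrite ler_wpM2r// -!natrM ler_nat leq_mul// mulnS add2n.
apply: (@le_trans _ _ ((2 * m.+1)%:R * (2 * m.+1)%:R * (4 ^+ m * m`!%:R ^+ 2))).
  by rewrite ler_wpM2l.
rewrite le_eqVlt; apply/orP; left; apply/eqP.
by rewrite !natrM [4 ^+ m.+1]exprS; set a := 4 ^+ m; set b := m`!%:R; set c := m.+1%:R; ring.
Qed.

Lemma l1_natE n : n%:R = n%:R%:A.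
Proof. by rewrite (rmorph_nat (@l1_cst R V)). Qed.

Lemma l1_norm_nat n : N n%:R = n%:R.
Proof. by rewrite l1_natE l1_norm_cst ger0_norm. Qed.

(** The polynomial contributes at most [(6 + 12 + 4) / 3] and the exponential tail at most
    [16 * 2^4 * K]; both are divided by 16. *)
Lemma remainder_norm (K : R) (v r : A) : N v <= 1 -> N r <= K ->
  N ((16^-1)%:A * ((3^-1)%:A * (6%:R - 12%:R * v + 4%:R * v ^+ 2)
     - 16%:R * ((1 - v) ^+ 4 * r))) <= 1 + 16 * K.
Proof.
have ar1 (a c : R) : a <= 1 -> c <= 1 -> 6 + 12 * a + 4 * c <= 22 by lra.
have ar2 (a : R) : a <= 3^-1 * 22 + 16 * (16 * K) -> 16^-1 * a <= 1 + 16 * K by lra.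
have pos16 : 0 <= 16^-1 :> R by lra.
have pos3 : 0 <= 3^-1 :> R by lra.
have e16 : 16 = 2 ^+ 4 :> R by rewrite -natrX.
have Nn (c : nat) (X : A) : N (c%:R * X) = c%:R * N X.
  by rewrite l1_natE l1_normZ ger0_norm.
move=> Nv Nr.
have Nv2 : N (v ^+ 2) <= 1.
  by apply: (le_trans (l1_normX v 2)); apply: exprn_ile1 Nv; exact: l1_norm_ge0.
have Nh : N (1 - v) <= 2.
  apply: (le_trans (l1_normD _ _)); rewrite l1_normN l1_norm1.
  exact: lerD (lexx 1) Nv.
have N1 : N (6%:R - 12%:R * v + 4%:R * v ^+ 2) <= 22.
  apply: (le_trans (l1_normD _ _)); rewrite (Nn 4%N).
  apply: (le_trans (lerD (l1_normD _ _) (lexx _))).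
  by rewrite (l1_normN (12%:R * v)) (Nn 12%N) (l1_norm_nat 6); exact: ar1.
have N2 : N ((1 - v) ^+ 4 * r) <= 16 * K.
  apply: (le_trans (l1_normM _ _)).
  apply: ler_pM Nr; [exact: l1_norm_ge0|exact: l1_norm_ge0|].
  apply: (le_trans (l1_normX (1 - v) 4)); rewrite e16.
  by apply: lerXn2r Nh; rewrite nnegrE ?l1_norm_ge0.
rewrite l1_normZ (ger0_norm pos16); apply: ar2.
move: N1 N2; set a := (6%:R - _ + _); set b := (_ ^+ 4 * r) => N1 N2.
apply: (le_trans (l1_normD _ _)); rewrite (l1_normN (16%:R * b)) (Nn 16%N b).
rewrite (l1_normZ _ a) (ger0_norm pos3); apply: lerD.
  exact: (ler_wpM2l pos3 N1).
exact: (ler_wpM2l (ler0n R 16) N2).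
Qed.

Variables (F : A) (q : R).
Hypotheses (FL : is_law F q) (q0 : 0 < q) (q1 : q < 1).
Hypothesis Fsym : forall x, F (- x) = F x.
Let p := 1 - q.
Let u := F - 1.
Let D := l1_exp (u - (2^-1)%:A * u ^+ 2).

Lemma norm_law_sub1 : N u <= 2.
Proof. by rewrite (le_trans (l1_normD _ _))// l1_normN l1_norm1 (law_norm FL). Qed.

Lemma law_sub_approx (K : R) : expR 4 <= K ->
  exists2 w : A, N w <= 1 + 16 * K &
  F - D = u ^+ 3 * ((3^-1)%:A + u * w).
Proof.
(* In terms of [v = u / 2] all coefficients are integers except for [b], so [ring] applies in the
   convolution algebra; moreover [N v <= 1]. *)
move=> eK; pose v := (2^-1)%:A * u; pose b := (3^-1)%:A.
have uv : u = 2%:R * v.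
  by rewrite /v mulrA l1_natE l1_cstMr mulfV ?rmorph1 ?mul1r.
pose t := u - (2^-1)%:A * u ^+ 2.
have tE : t = 2%:R * (v - v ^+ 2).
  by rewrite /t expr2 mulrA -/v {1}uv uv; ring.
have Nv : N v <= 1.
  by rewrite l1_normZ ger0_norm ?invr_ge0//; have := norm_law_sub1; lra.
have three X : X = b * (3%:R * X).
  by rewrite mulrA l1_natE l1_cstMr mulVf ?rmorph1 ?mul1r// pnatr_eq0.
have [r Nr] := l1_exp_tail4 t; rewrite -/D => DE.
have Nh : N (1 - v) <= 2.
  by rewrite (le_trans (l1_normD _ _))// l1_normN l1_norm1 lerD.
(* Two factors of norm at most 2 give [N t <= 4], whence the constant [expR 4]; the factor [u] also
   shows that [t ^+ 4] is divisible by [u ^+ 4]. *)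
have tuh : t = u * (1 - v) by rewrite tE uv; ring.
have Nr4 : N r <= K.
  apply: (le_trans Nr); apply: le_trans eK; rewrite ler_expR tuh.
  apply: (le_trans (l1_normM _ _)).
  have -> : 4 = 2 * 2 :> R by ring.
  apply: ler_pM; [exact: l1_norm_ge0|exact: l1_norm_ge0|exact: norm_law_sub1|exact: Nh].
clear Nr eK.
pose w' := b * (6%:R - 12%:R * v + 4%:R * v ^+ 2) - 16%:R * ((1 - v) ^+ 4 * r).
have e1 : (2^-1)%:A * t ^+ 2 = 2%:R * (v - v ^+ 2) ^+ 2.
  have -> : t ^+ 2 = 2%:R * (2%:R * (v - v ^+ 2) ^+ 2) by rewrite tE; ring.
  by rewrite mulrA [in X in _ * X * _]l1_natE l1_cstMr mulVf ?pnatr_eq0// rmorph1 mul1r.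
have e2 : (6^-1)%:A * t ^+ 3 = b * (4%:R * (v - v ^+ 2) ^+ 3).
  have -> : t ^+ 3 = 2%:R * (4%:R * (v - v ^+ 2) ^+ 3) by rewrite tE; ring.
  rewrite mulrA (l1_natE 2) l1_cstMr.
  have h62 : 6^-1 * 2%:R = 3^-1 :> R by field.
  by rewrite h62 -/b.
exists ((16^-1)%:A * w'); first exact: remainder_norm.
have FE : F = 1 + u by rewrite /u addrC subrK.
have u4 : u ^+ 4 * (16^-1)%:A = v ^+ 4.
  have -> : u ^+ 4 = v ^+ 4 * 16%:R by rewrite uv; ring.
  have h16 : 16%:R * 16^-1 = 1 :> R by rewrite mulfV ?pnatr_eq0.
  by rewrite -mulrA (l1_natE 16) l1_cstMr h16 rmorph1 mulr1.
have -> : u ^+ 3 * (b + u * ((16^-1)%:A * w')) = u ^+ 3 * b + (u ^+ 4 * (16^-1)%:A) * w'.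
  by ring.
rewrite u4 DE e1 e2 FE.
have -> : t ^+ 4 * r = 16%:R * v ^+ 4 * (1 - v) ^+ 4 * r by rewrite tuh uv; ring.
rewrite tE uv.
have := three (4%:R * v ^+ 3 - 2%:R * v ^+ 4) => h.
transitivity (4%:R * v ^+ 3 - 2%:R * v ^+ 4 - b * (4%:R * (v - v ^+ 2) ^+ 3)
   - 16%:R * v ^+ 4 * (1 - v) ^+ 4 * r); first by ring.
by rewrite h /w'; ring.
Qed.

Lemma norm_exp_le1 y : 0 <= y -> N (l1_exp (y%:A * u)) <= 1.
Proof.
move=> y0; have NF : N F <= 1 by rewrite (law_norm FL).
have [_] := norm_exp_poisson NF y0 1; rewrite mul1r => h; apply: le_trans h _.
have [ps p1] := poisson_sum y0; rewrite -[leRHS]p1; apply: le_rsum => //.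
  apply: le_abs_summable (ps) => j.
  rewrite [leLHS]normrM ler_piMr// mul1r ger0_norm ?l1_norm_ge0//.
  exact: law_normX FL j.
by move=> j; rewrite mul1r ler_piMr ?(law_normX FL)// poisson_ge0.
Qed.

(** [T = exp (y u) exp (- l u^2 / 2)] with [y = (1 - q/4) l]. The second exponential is expanded,
    and each power [u^(2m)] is paid for by [exp (y u)]; the terms then form a geometric series. *)
Lemma approx_pow l : (0 < l)%N -> exists2 T : A, N T <= 2 / q &
  D ^+ l = l1_exp ((l%:R * q / 4)%:A * u) * T.
Proof.
move=> l0; have l0R : 0 < l%:R :> R by rewrite ltr0n.
pose y := (1 - q / 4) * l%:R; pose s := - (l%:R / 2) : R.
have q4 : 0 < 1 - q / 4 by move: q1; lra.
have y0 : 0 < y by exact: mulr_gt0.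
exists (l1_exp (y%:A * u) * l1_exp (s%:A * u ^+ 2)); last first.
  have key (a b c : A) : l1_exp a * (l1_exp b * l1_exp c) = l1_exp (a + b + c).
    by rewrite mulrA !l1_expD.
  have key2 (a b : R) (X : A) : a%:A * X + b%:A * X = (a + b)%:A * X.
    by rewrite rmorphD mulrDl.
  rewrite /D l1_expMn key key2; apply: (congr1 (@l1_exp R V)).
  have -> : l%:R * q / 4 + y = l%:R by rewrite /y; ring.
  rewrite mulrBr mulrA l1_cstMr; apply: (congr1 (fun X => _ + X)).
  by rewrite /s rmorphN mulNr.
have p0 : 0 < p by rewrite subr_gt0.
(* The intended ratio of the geometric series; its sum [1 / (1 - r)] is the [2 / q] of the
   statement. *)
pose r := 1 - q / 2; have r0 : 0 <= r by rewrite /r; move: q1; lra.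
have r1 : r < 1 by rewrite /r; move: q0; lra.
have [gs ge] : abs_summable (fun m => r ^+ m) /\ rsum (fun m => r ^+ m) = 2 / q.
  apply: rsum_natE => [m|]; first by rewrite exprn_ge0.
  have := @cvg_geometric_series R 1 r; rewrite ger0_norm// => /(_ r1).
  rewrite (_ : 1 / (1 - r) = 2 / q); last by rewrite /r; field; rewrite gt_eqF.
  rewrite (_ : geometric 1 r = fun m => r ^+ m)//.
  by apply/funext => m; rewrite /geometric /= mul1r.
have es := l1_exp_summable (s%:A * u ^+ 2).
rewrite (l1_mul_sum _ es) (le_trans (l1_norm_l1_sum (l1_norm_summableM _ es)))//.
rewrite -[leRHS]ge; apply: le_rsum; [exact: l1_norm_summableM|exact: gs|].
move=> m; have -> : l1_exp (y%:A * u) * l1_exp_term (s%:A * u ^+ 2) m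
    = (m`!%:R^-1 * s ^+ m)%:A * (u ^+ (2 * m) * l1_exp (y%:A * u)).
  rewrite /l1_exp_term exprMn l1_cstX -exprM rmorphM.
  by set a := l1_exp _; set b := u ^+ _; ring.
rewrite l1_normZ.
set t := N _; have t0 : 0 <= t by exact: l1_norm_ge0.
(* The laziness [q / 4] loses a factor [1 - q p / 4 >= 1 - q / 4], the same order as the part of the
   exponent withheld for smoothing. *)
have eb : 0 < q / 4 <= 1 by move: q0 q1; lra.
have := @law_exp_smoothing R V F q FL q0 q1 (q / 4) y (2 * m) eb y0; rewrite -/t -/p.
set z := (_ * y / p) => h.
have z0 : 0 < z.
  apply: divr_gt0 p0; apply: mulr_gt0 y0.
  by have /andP[] := lazy_bounds q0 q1 eb.
rewrite normrM ger0_norm ?invr_ge0// normrX normrN ger0_norm ?divr_ge0//.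
rewrite -(@ler_pXn2r _ 2)// ?nnegrE ?exprn_ge0 ?mulr_ge0 ?exprn_ge0 ?divr_ge0//.
have z2m : 0 < z ^+ (2 * m) by rewrite exprn_gt0.
rewrite -(ler_pM2r z2m).
have m0 : (m`!%:R : R) != 0 by rewrite pnatr_eq0 -lt0n fact_gt0.
apply: (@le_trans _ _ ((m`!%:R^-1 * (l%:R / 2) ^+ m) ^+ 2 * (2 * m)`!%:R)).
  by rewrite [(_ * t) ^+ 2]exprMn -mulrA; apply: ler_wpM2l h; exact: sqr_ge0.
apply: (@le_trans _ _ ((m`!%:R^-1 * (l%:R / 2) ^+ m) ^+ 2 * (4 ^+ m * m`!%:R ^+ 2))).
  by rewrite ler_wpM2l ?sqr_ge0// bin_2m_le.
rewrite (_ : _ * (4 ^+ m * _) = (l%:R ^+ 2) ^+ m); last first.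
  rewrite (_ : l%:R ^+ 2 = (l%:R / 2) ^+ 2 * 4); last by field.
  rewrite [RHS]exprMn exprAC.
  by set a := (_ / 2) ^+ m; set c := 4 ^+ m; field.
have -> : (r ^+ m) ^+ 2 * z ^+ (2 * m) = ((r * z) ^+ 2) ^+ m.
  by rewrite exprM (exprAC r) -exprMn -(exprMn 2).
apply: lerXn2r; rewrite ?nnegrE ?sqr_ge0//.
apply: lerXn2r; rewrite ?nnegrE//; first by rewrite mulr_ge0// ltW.
rewrite /z mulrA ler_pdivlMr// mulrC.
rewrite (_ : r * _ = l%:R * (r * ((1 - q / 4 * p) * (1 - q / 4)))); last by rewrite /y; ring.
rewrite [p * _]mulrC ler_wpM2l//.
have h1 : (1 - q / 4) * (1 - q / 4) <= (1 - q / 4 * p) * (1 - q / 4).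
  rewrite ler_wpM2r//; first by lra.
  by rewrite lerD2l lerN2 ler_piMr// /p; lra.
apply: (@le_trans _ _ (r * ((1 - q / 4) * (1 - q / 4)))); last by rewrite ler_wpM2l.
(* What remains is [1 - q <= (1 - q/2) (1 - q/4)^2]: the linear terms agree and the quadratic
   surplus [5 q^2 / 16] dominates [q^3 / 32]. *)
by rewrite /r /p; nra.
Qed.

Lemma norm_approx_pow l : N (D ^+ l) <= 2 / q.
Proof.
case: l => [|l].
  by rewrite expr0 l1_norm1 ler_pdivlMr// mul1r; move: q1; lra.
have [T NT ->] := @approx_pow l.+1 isT; rewrite (le_trans (l1_normM _ _))//.
apply: le_trans NT; rewrite ler_piMl ?l1_norm_ge0// norm_exp_le1//.
by rewrite divr_ge0// mulr_ge0// ltW.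
Qed.

End approximation.

(** * Assembly of the leading term and the error terms *)

Section main_bound.
Context {R : realType} {V : zmodType}.
Local Notation A := (l1 R V).
Local Notation N := (@l1_norm R V).
Local Notation "c %:A" := (@l1_cst R V c) : ring_scope.

Lemma le_l1_normM (a b : A) (x y : R) : N a <= x -> N b <= y -> N (a * b) <= x * y.
Proof.
move=> ax bY; apply: (le_trans (l1_normM a b)).
exact: ler_pM (l1_norm_ge0 a) (l1_norm_ge0 b) ax bY.
Qed.

Lemma le_l1_normX (a : A) (x : R) k : N a <= x -> N (a ^+ k) <= x ^+ k.
Proof.
move=> ax; have a0 := l1_norm_ge0 a; have x0 := le_trans a0 ax.
by apply: (le_trans (l1_normX a k)); apply: lerXn2r ax; rewrite nnegrE.
Qed.

(** Here [a = sqrt q] and [b = sqrt n]. After extraction of [b^2 S^3 / (a^8 b)] the leading terms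
    compare as [1/48 <= 7/96] and the errors as [1 <= 21/20]. The number 216/15 is chosen so that
    [15.75 / 216] times it still exceeds 1. *)
Lemma error_terms_le (K0 a b S : R) : 0 <= K0 -> 0 < a -> a <= 1 -> 0 < b -> 0 <= S ->
  2^-1 * (b ^+ 2 * (24^-1 * S ^+ 3 + K0 * S ^+ 3 * (14 / (a * b)))
   + b ^+ 2 * b ^+ 2 * ((1 + 2 * K0) ^+ 2
     * (2 / a ^+ 2 * ((32 * S) ^+ 3 * (14 / (a * b)) ^+ 3))))
  <= 1575 / 100 * (b ^+ 2 * a ^+ 2 / 6 * S) ^+ 3 / (a ^+ 7 * (b ^+ 2) ^+ 2)
    * (1 + 216 / 15 * (7 * K0 + (1 + 2 * K0) ^+ 2 * 32 ^+ 3 * 14 ^+ 3) / (a ^+ 7 * b)).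
Proof.
move=> K00 a0 a1 b0 S0; have an0 : a != 0 by rewrite gt_eqF.
have bn0 : b != 0 by rewrite gt_eqF.
set c2 := (1 + 2 * K0) ^+ 2 * 32 ^+ 3 * 14 ^+ 3.
have c20 : 0 <= c2 by apply: mulr_ge0; [apply: mulr_ge0; [exact: sqr_ge0|]|]; exact: exprn_ge0.
have -> : 2^-1 * (b ^+ 2 * (24^-1 * S ^+ 3 + K0 * S ^+ 3 * (14 / (a * b)))
   + b ^+ 2 * b ^+ 2 * ((1 + 2 * K0) ^+ 2
     * (2 / a ^+ 2 * ((32 * S) ^+ 3 * (14 / (a * b)) ^+ 3)))) =
   b ^+ 2 * S ^+ 3 / (a ^+ 8 * b) *
     (48^-1 * (a ^+ 8 * b) + (7 * K0 * a ^+ 7 + c2 * a ^+ 3)).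
  by rewrite /c2; field; rewrite an0 bn0.
have -> : 1575 / 100 * (b ^+ 2 * a ^+ 2 / 6 * S) ^+ 3 / (a ^+ 7 * (b ^+ 2) ^+ 2)
    * (1 + 216 / 15 * (7 * K0 + c2) / (a ^+ 7 * b)) =
   b ^+ 2 * S ^+ 3 / (a ^+ 8 * b) *
     (7 / 96 * (a ^+ 7 * b) + 21 / 20 * (7 * K0 + c2)).
  by field; rewrite an0 bn0.
have h7 : 0 <= a ^+ 7 <= 1 by rewrite exprn_ge0 ?exprn_ile1 ?(ltW a0).
have h3 : 0 <= a ^+ 3 <= 1 by rewrite exprn_ge0 ?exprn_ile1 ?(ltW a0).
apply: ler_wpM2l.
  rewrite divr_ge0//; first by rewrite mulr_ge0 ?exprn_ge0// ltW.
  by rewrite mulr_ge0 ?exprn_ge0 ?(ltW a0)// ltW.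
apply: lerD.
  rewrite exprS -mulrA; set w := a ^+ 7 * b.
  have w0 : 0 <= w by rewrite mulr_ge0 ?(ltW b0)//; case/andP: h7.
  have : a * w <= w by rewrite ler_piMl.
  by move: w0; lra.
have k7 : 7 * K0 * a ^+ 7 <= 7 * K0.
  by rewrite ler_piMr ?mulr_ge0//; case/andP: h7.
have k3 : c2 * a ^+ 3 <= c2 by rewrite ler_piMr//; case/andP: h3.
by move: c20 K00 k7 k3; lra.
Qed.

Variables (F : A) (q : R).
Hypotheses (FL : is_law F q) (q0 : 0 < q) (q1 : q < 1).
Hypothesis Fsym : forall x, F (- x) = F x.
Let p := 1 - q.
Let u := F - 1.
Let D := l1_exp (u - (2^-1)%:A * u ^+ 2).

Variable n : nat.
Hypothesis n0 : (0 < n)%N.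
Let S := min_sum F (6 / (n%:R * q)).
(** The common bound for a factor [u] not estimated through [delta]. The worst case, in
    [u_exp_generic], gives the square [192 / (n q)], and [14^2 = 196]. *)
Let g := 14 / (Num.sqrt q * Num.sqrt n%:R).

Let nR0 : 0 < n%:R :> R. Proof. by rewrite ltr0n. Qed.

Let nq0 : 0 < n%:R * q. Proof. by rewrite mulr_gt0. Qed.

Let z0 : 0 <= 6 / (n%:R * q). Proof. by rewrite divr_ge0// ltW. Qed.

Let S0 : 0 <= S. Proof. exact: (min_sum_ge0 FL z0). Qed.

Let g0 : 0 <= g.
Proof. by rewrite divr_ge0// mulr_ge0// sqrtr_ge0. Qed.

Let le_g (t x : R) : 0 < x -> 0 <= t -> t ^+ 2 * x <= 1 ->
  n%:R * q <= 192 * x -> t <= g.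
Proof.
move=> x0 t0 tx nx; rewrite -(@ler_pXn2r _ 2) ?nnegrE//.
have -> : g ^+ 2 = 196 / (n%:R * q).
  rewrite /g expr_div_n exprMn !sqr_sqrtr ?(ltW q0) ?ler0n//.
  by rewrite (mulrC q) -natrX.
rewrite ler_pdivlMr//; apply: (@le_trans _ _ (t ^+ 2 * (192 * x))).
  by apply: ler_wpM2l nx; exact: sqr_ge0.
by rewrite mulrCA; move: tx; set v := t ^+ 2 * x; lra.
Qed.

(** The integer [c] records how much shorter the block is than [n / 6]. Only [c = 1], without loss,
    is affordable in the leading term. *)
Lemma u_law_delta c M : (0 < c)%N -> (n <= 6 * c * M.+1)%N ->
  N (u * F ^+ (2 * M)) <= c%:R * S / 2.
Proof.
move=> c0 hn; have c1 : 1 <= c%:R :> R by rewrite ler1n.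
apply: le_trans (_ : min_sum F (c%:R * (6 / (n%:R * q))) / 2 <= _).
  apply: (law_pow_bound FL Fsym q0).
  rewrite (_ : _ * (q * M.+1%:R) = (6 * c * M.+1)%:R / n%:R).
    by rewrite ler_pdivlMr// mul1r ler_nat.
  by rewrite !natrM; field; rewrite !gt_eqF.
rewrite ler_wpM2r ?invr_ge0//; apply: (min_sum_scale FL c1 z0) (lexx _).
by rewrite mulr_ge0.
Qed.

Lemma u_law_generic M : (n <= 192 * M.+1)%N -> N (u * F ^+ M) <= g.
Proof.
move=> hn; have Mq : 0 < M.+1%:R * q by rewrite mulr_gt0.
apply: (le_g Mq); first exact: l1_norm_ge0.
  have := law_smoothing FL q0 q1 1 M; rewrite !expr1 addn1 bin1 => h.
  by apply: le_trans h _; rewrite gerBl ltW.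
by rewrite mulrA ler_wpM2r ?(ltW q0)// -natrM ler_nat.
Qed.

(** [exp (j q u / 4)] is shared by six factors [u], hence 24; halving again for the two first
    differences gives 48. The level [64 * 6 / (n q)] times [j q / 48] is [8 j / n >= 2], and half of
    64 is the 32. *)
Lemma u_exp_delta j : (0 < j)%N -> (n <= 4 * j)%N ->
  N (u * l1_exp ((j%:R * q / 24)%:A * u)) <= 32 * S.
Proof.
move=> j0 nj; have jR : 0 < j%:R :> R by rewrite ltr0n.
have jq : 0 < j%:R * q by rewrite mulr_gt0.
have y0 : 0 < j%:R * q / 48 by rewrite divr_gt0.
have -> : j%:R * q / 24 = 2 * (j%:R * q / 48) by field.
apply: le_trans (_ : min_sum F (64 * (6 / (n%:R * q))) / 2 <= _).
  apply: (law_exp_bound FL Fsym _ y0); first by rewrite q0.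
  rewrite (_ : _ * (j%:R * q / 48) = 2 * (4 * j)%:R / n%:R).
    by rewrite ler_pdivlMr// ler_wpM2l// ler_nat.
  by rewrite natrM; field; rewrite !gt_eqF.
rewrite ler_pdivrMr// mulrAC (_ : 32 * 2 = 64 :> R); last by ring.
apply: (min_sum_scale FL _ z0) (lexx _); first by rewrite ler1n.
by rewrite mulr_ge0.
Qed.

Lemma u_exp_generic j : (0 < j)%N -> (n <= 4 * j)%N ->
  N (u * l1_exp ((j%:R * q / 24)%:A * u)) <= g.
Proof.
move=> j0 nj; have jR : 0 < j%:R :> R by rewrite ltr0n.
have jq : 0 < j%:R * q by rewrite mulr_gt0.
have y0 : 0 < j%:R * q / 24 by rewrite divr_gt0.
have p0 : 0 < p by rewrite subr_gt0.
have p1 : p < 1 by rewrite gtrBl.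
have hb : 0 < (2^-1 : R) <= 1 by lra.
have x0 : 0 < j%:R * q / 48 by rewrite divr_gt0.
apply: (le_g x0); first exact: l1_norm_ge0.
  have := law_exp_smoothing FL q0 q1 1 hb y0; rewrite !expr1 => h.
  apply: le_trans h; apply: ler_wpM2l; first exact: sqr_ge0.
  rewrite ler_pdivlMr//.
  rewrite (_ : j%:R * q / 48 * p = j%:R * q / 24 * (2^-1 * p)); last by field.
  rewrite [leRHS]mulrC ler_wpM2l ?(ltW y0)//.
  by rewrite -/p; move: (p) p0 p1 => r r0 r1; lra.
rewrite (_ : 192 * (j%:R * q / 48) = (4 * j)%:R * q); last by rewrite natrM; field.
by rewrite ler_wpM2r ?(ltW q0)// ler_nat.
Qed.

Lemma second_order i j : (i + j + 2)%N = n ->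
  N (u ^+ 6 * (F ^+ i * D ^+ j)) <= 2 / q * ((32 * S) ^+ 3 * g ^+ 3).
Proof.
(* The larger exponent does the smoothing. If it is [i], then [D ^+ j] enters only through its norm
   [2 / q]; otherwise its exponential part smooths and [F ^+ i] is merely bounded by 1. *)
move=> ijn; have [ji|ij] := leqP j i.
  (* Nine blocks: three of length [2 M] for the factors bounded by [S], three of length [M] for
     those bounded by [g]. *)
  pose M := (i %/ 9)%N; pose r := (i %% 9)%N.
  have iE : (i = 3 * (2 * M) + (3 * M + r))%N.
    by rewrite [LHS](divn_eq i 9) -/M -/r; ring.
  have nM : (n <= 18 * M.+1)%N.
    have : (i < 9 * M.+1)%N by rewrite mulnC -ltn_divLR.
    by rewrite -ijn; lia.
  have -> : u ^+ 6 * (F ^+ i * D ^+ j) =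
      D ^+ j * ((u * F ^+ (2 * M)) ^+ 3 * (u * F ^+ M) ^+ 3) * F ^+ r.
    have -> : F ^+ i = (F ^+ (2 * M)) ^+ 3 * ((F ^+ M) ^+ 3 * F ^+ r).
      by rewrite -!exprM -!exprD [i in LHS]iE; congr (F ^+ _); lia.
    by set a := F ^+ (2 * M); set b := F ^+ M; set c := F ^+ r; set d := D ^+ j; ring.
  rewrite -[leRHS]mulr1; apply: le_l1_normM; last exact: law_normX FL r.
  apply: le_l1_normM; first exact: norm_approx_pow.
  apply: le_l1_normM; apply: le_l1_normX; last first.
    by apply: u_law_generic; lia.
  apply: (@le_trans _ _ (3%:R * S / 2)); first by apply: u_law_delta => //; lia.
  by move: S0; lra.
have j0 : (0 < j)%N by lia.
have nj : (n <= 4 * j)%N by lia.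
have [T NT DT] := approx_pow FL q0 q1 j0.
rewrite -/u -/D in DT; set e := l1_exp ((j%:R * q / 24)%:A * u).
have eE : l1_exp ((j%:R * q / 4)%:A * u) = e ^+ 6.
  have key (c : R) k : l1_exp (c%:A * u) ^+ k = l1_exp ((k%:R * c)%:A * u).
    by rewrite l1_expMn mulrA l1_cstMr.
  have h : 6%:R * (j%:R * q / 24) = j%:R * q / 4 by field.
  by rewrite /e key h.
rewrite DT eE.
have -> : u ^+ 6 * (F ^+ i * (e ^+ 6 * T)) =
    T * ((u * e) ^+ 3 * (u * e) ^+ 3) * F ^+ i.
  by move: (F ^+ i) => a; ring.
rewrite -[leRHS]mulr1; apply: le_l1_normM; last exact: law_normX FL i.
apply: le_l1_normM; first exact: NT.
apply: le_l1_normM; apply: le_l1_normX; first exact: u_exp_delta.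
exact: u_exp_generic.
Qed.

Lemma first_order m : m.+1 = n ->
  N (u ^+ 3 * F ^+ m) <= 8^-1 * S ^+ 3 /\ N (u ^+ 4 * F ^+ m) <= S ^+ 3 * g.
Proof.
move=> mn; split.
  (* Three factors [u], each with two first differences, need six blocks; this is the origin of the
     argument [n q / 6] of [delta]. *)
  pose M := (m %/ 6)%N; pose r := (m %% 6)%N.
  have mE : (m = 3 * (2 * M) + r)%N by rewrite [LHS](divn_eq m 6) -/M -/r; ring.
  have nM : (n <= 6 * 1 * M.+1)%N.
    have : (m < 6 * M.+1)%N by rewrite mulnC -ltn_divLR.
    by rewrite -mn; lia.
  have -> : u ^+ 3 * F ^+ m = (u * F ^+ (2 * M)) ^+ 3 * F ^+ r.
    have -> : F ^+ m = (F ^+ (2 * M)) ^+ 3 * F ^+ r.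
      by rewrite -exprM -exprD [m in LHS]mE; congr (F ^+ _); lia.
    by rewrite exprMn mulrA.
  rewrite -[leRHS]mulr1; apply: le_l1_normM; last exact: law_normX FL r.
  rewrite (_ : 8^-1 * S ^+ 3 = (1%:R * S / 2) ^+ 3); last by field.
  by apply: le_l1_normX; exact: u_law_delta.
(* A seventh block serves the extra [u]. The shorter blocks force [c = 2], which is harmless in an
   error term: [(2 S / 2)^3 = S^3]. *)
pose M := (m %/ 7)%N; pose r := (m %% 7)%N.
have mE : (m = 3 * (2 * M) + (M + r))%N by rewrite [LHS](divn_eq m 7) -/M -/r; ring.
have nM : (n <= 7 * M.+1)%N.
  have : (m < 7 * M.+1)%N by rewrite mulnC -ltn_divLR.
  by rewrite -mn; lia.
have -> : u ^+ 4 * F ^+ m = (u * F ^+ (2 * M)) ^+ 3 * (u * F ^+ M) * F ^+ r.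
  have -> : F ^+ m = (F ^+ (2 * M)) ^+ 3 * (F ^+ M * F ^+ r).
    by rewrite -exprM -!exprD [m in LHS]mE; congr (F ^+ _); lia.
  by set a := F ^+ (2 * M); set b := F ^+ M; set c := F ^+ r; ring.
rewrite -[leRHS]mulr1; apply: le_l1_normM; last exact: law_normX FL r.
apply: le_l1_normM; last by apply: u_law_generic; lia.
rewrite (_ : S ^+ 3 = (2%:R * S / 2) ^+ 3); last by field.
by apply: le_l1_normX; apply: u_law_delta => //; lia.
Qed.

Lemma law_approx_bound (K K0 : R) : expR 4 <= K -> K0 = 1 + 16 * K ->
  2^-1 * N (F ^+ n - D ^+ n) <=
    1575 / 100 * (n%:R * q / 6 * S) ^+ 3 / (Num.sqrt q ^+ 7 * n%:R ^+ 2)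
    * (1 + 216 / 15 * (7 * K0 + (1 + 2 * K0) ^+ 2 * 32 ^+ 3 * 14 ^+ 3)
             / (Num.sqrt q ^+ 7 * Num.sqrt n%:R)).
Proof.
move=> eK K0E.
have K00 : 0 <= K0.
  by rewrite K0E addr_ge0// mulr_ge0//; apply: le_trans eK; exact: expR_ge0.
have [w Nw FD] := law_sub_approx FL eK.
rewrite -/u -/D -K0E in Nw FD; clear eK.
have a0 : 0 < Num.sqrt q by rewrite sqrtr_gt0.
have b0 : 0 < Num.sqrt n%:R :> R by rewrite sqrtr_gt0.
have a1 : Num.sqrt q <= 1 by rewrite -sqrtr1 ler_wsqrtr// ltW.
apply: le_trans (_ : 2^-1 * (n%:R * (24^-1 * S ^+ 3 + K0 * S ^+ 3 * g)
   + n%:R * n%:R * ((1 + 2 * K0) ^+ 2 * (2 / q * ((32 * S) ^+ 3 * g ^+ 3)))) <= _); last first.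
  have := error_terms_le K00 a0 a1 b0 S0.
  by rewrite !sqr_sqrtr ?(ltW q0) ?ler0n.
apply: ler_wpM2l; first by rewrite invr_ge0.
have [m mn] : exists m, m.+1 = n by exists n.-1; rewrite prednK.
have idx j k : (j < k)%N -> (k < n)%N -> (m.-1 - j + j + 2)%N = n.
  rewrite -mn ltnS => jk km; have jm : (j < m)%N := leq_trans jk km.
  by case: m jm {mn km} => // m jm; rewrite /= subnK// addn2.
have [h3 h4] := first_order mn.
rewrite -mn subrXX_order2 mn FD.
apply: (le_trans (l1_normD _ _)); rewrite (l1_normN (_ * \sum_(k < n) _)); apply: lerD.
  apply: le_l1_normM; first by rewrite l1_norm_nat.
  have -> : u ^+ 3 * ((3^-1)%:A + u * w) * F ^+ m =
      (3^-1)%:A * (u ^+ 3 * F ^+ m) + w * (u ^+ 4 * F ^+ m).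
    by move: (F ^+ m) => f; ring.
  apply: (le_trans (l1_normD _ _)); apply: lerD.
    rewrite (_ : 24^-1 * S ^+ 3 = 3^-1 * (8^-1 * S ^+ 3)); last by field.
    by apply: le_l1_normM h3; rewrite l1_norm_cst ger0_norm ?invr_ge0.
  by rewrite -[leRHS]mulrA; apply: le_l1_normM h4.
have NW : N ((3^-1)%:A + u * w) <= 1 + 2 * K0.
  apply: (le_trans (l1_normD _ _)); apply: lerD.
    by rewrite l1_norm_cst ger0_norm ?invr_ge0// invf_le1// ler1n.
  by apply: le_l1_normM Nw; exact: (norm_law_sub1 FL).
set B := 2 / q * _ in h4 *.
have B0 : 0 <= B.
  apply: mulr_ge0; first by rewrite divr_ge0 ?(ltW q0).
  by apply: mulr_ge0; apply: exprn_ge0; [exact: mulr_ge0|exact: g0].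
have K1 : 0 <= (1 + 2 * K0) ^+ 2 by exact: sqr_ge0.
(* The factor [u ^+ 6] of [E^2] is moved inside the double sum, so that every [F ^+ i * D ^+ j] can
   smooth its own copy. *)
have -> : (u ^+ 3 * ((3^-1)%:A + u * w)) ^+ 2
      * (\sum_(k < n) \sum_(j < k) F ^+ (m.-1 - j) * D ^+ j)
    = ((3^-1)%:A + u * w) ^+ 2
      * \sum_(k < n) \sum_(j < k) (u ^+ 6 * (F ^+ (m.-1 - j) * D ^+ j)).
  under [in RHS]eq_bigr => k _ do rewrite -mulr_sumr.
  rewrite -mulr_sumr; move: (\sum_(k < n) _) => f; move: ((3^-1)%:A + u * w) => f2.
  by ring.
rewrite [leRHS]mulrCA; apply: le_l1_normM; first exact: le_l1_normX.
apply: (le_trans (l1_norm_sum _ _ _)).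
rewrite -mulrA mulr_natl -[X in _ *+ X](card_ord n) -sumr_const.
apply: ler_sum => -[k /= kn] _; apply: (le_trans (l1_norm_sum _ _ _)).
apply: (@le_trans _ _ (\sum_(j < k) B)); last first.
  by rewrite sumr_const card_ord -[leLHS]mulr_natl; apply: ler_wpM2r B0 _ _ _; rewrite ler_nat ltnW.
apply: ler_sum => -[j /= jk] _; apply: second_order.
exact: (idx _ _ jk kn).
Qed.

End main_bound.

(** * Charges on the lattice *)

(** Countable additivity is indexed by [nat]; [pickle_inv] carries it over to [J], with the empty
    set at indices that encode nothing. *)
Lemma measure_countable_partition (R : realType) (dd : measure_display)
    (X : measurableType dd) (mu : {measure set X -> \bar R}) (J : countType)
    (E : J -> set X) (B : set X) :
  (forall j, measurable (E j)) -> trivIset [set: J] E -> measurable B ->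
  mu (B `\` \bigcup_j E j) = 0%E -> mu B = \esum_(j in [set: J]) mu (B `&` E j).
Proof.
move=> mE tE mB B0.
pose F n := if pickle_inv n is Some j then B `&` E j else set0.
have mF n : measurable (F n).
  by rewrite /F; case: pickle_inv => // j; exact: measurableI.
have tF : trivIset [set: nat] F.
  apply/trivIsetP => m n _ _ mn; rewrite /F.
  case Em: (pickle_inv m) => [j|]; last by rewrite set0I.
  case En: (pickle_inv n) => [k|]; last by rewrite setI0.
  have jk : j != k.
    apply: contra_neq mn => jk.
    have := @pickle_invK J m; rewrite Em /= => <-.
    by have := @pickle_invK J n; rewrite En /= => <-; rewrite jk.
  by move/trivIsetP : tE => /(_ j k I I jk) jk0; rewrite setIACA jk0 setI0.
have FE : \bigcup_n F n = B `&` \bigcup_j E j.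
  apply/seteqP; split=> [x [n _]|x [Bx [j _ Ejx]]].
    by rewrite /F; case: pickle_inv => // j [Bx Ejx]; split=> //; exists j.
  by exists (pickle j) => //; rewrite /F pickleK_inv.
have mU : measurable (\bigcup_n F n) by exact: bigcupT_measurable.
have BE : B `\` \bigcup_j E j = B `\` \bigcup_n F n.
  by rewrite FE setDIr setDv set0U.
have mD : measurable (B `\` \bigcup_j E j) by rewrite BE; exact: measurableD.
have -> : mu B = mu (\bigcup_n F n).
  rewrite -[in LHS](setUIDK B (\bigcup_j E j)) measureU//.
  - by rewrite [X in (_ + X)%E]B0 adde0 FE.
  - by rewrite -FE.
  - by rewrite setDE setIACA setICr setI0.
rewrite measure_semi_bigcup// nneseries_esumT; last by move=> n; exact: measure_ge0.
transitivity (\esum_(n in [set pickle j | j in [set: J]]) mu (F n)).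
  rewrite [RHS]esum_mkcond; apply: eq_esum => n _; case: ifPn => // /negP nr.
  rewrite /F; case En: (pickle_inv n) => [j|]; last by rewrite measure0.
  exfalso; apply: nr; rewrite inE; exists j => //.
  by have := @pickle_invK J n; rewrite En.
rewrite esum_image; last by move=> i j _ _; exact: (pcan_inj pickleK).
by apply: eq_esum => j _; rewrite /F pickleK_inv.
Qed.

Section lattice.
Context {R : realType} {d : nat}.
Local Notation T := (d.-tuple R).
Local Notation V := 'rV[int]_d.

(** Integer row vectors form the group on which the algebra [l1] is built; this embedding links them
    to the tuples carrying the measures. *)
Definition lat (v : V) : T := [tuple (v ord0 i)%:~R | i < d].

Lemma tnth_lat v i : tnth (lat v) i = (v ord0 i)%:~R.
Proof. by rewrite tnth_mktuple. Qed.

Lemma lat_inj : injective lat.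
Proof.
move=> v w vw; apply/rowP => i; apply: (@intr_inj R).
by rewrite -!tnth_lat vw.
Qed.

Lemma lat0 : lat 0 = vzero.
Proof. by apply: eq_from_tnth => i; rewrite tnth_lat tnth_mktuple mxE. Qed.

Lemma latN v : lat (- v) = vopp (lat v).
Proof.
by apply: eq_from_tnth => i; rewrite tnth_lat tnth_mktuple mxE rmorphN tnth_lat.
Qed.

Lemma latD v w : lat (v + w) = vadd (lat v, lat w).
Proof.
by apply: eq_from_tnth => i; rewrite tnth_lat tnth_mktuple mxE rmorphD !tnth_lat.
Qed.

Lemma vadd_lat_inj v : injective (fun y : T => vadd (lat v, y)).
Proof.
move=> y z /(congr1 (fun t => tnth t _)) h; apply: eq_from_tnth => i.
by have := h i; rewrite !tnth_mktuple /= => /addrI.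
Qed.

Lemma range_lat : range lat = lattice.
Proof.
apply/seteqP; split=> [_ [v _ <-] i|x xl]; first by rewrite tnth_lat intr_int.
exists (\row_i Num.floor (tnth x i)) => //.
by apply: eq_from_tnth => i; rewrite tnth_lat mxE floorK.
Qed.

Lemma lat_lattice v : lattice (lat v). Proof. by rewrite -range_lat; exists v. Qed.

Lemma measurable_tuple_set1 (x : T) : measurable [set x].
Proof.
rewrite (_ : [set x] = \bigcap_(i in [set: 'I_d]) ((@tnth _ _)^~ i) @^-1` [set tnth x i]).
  apply: fin_bigcap_measurable; first exact: finite_finset.
  by move=> i _; rewrite -[X in measurable X]setTI; exact: measurable_tnth.
apply/seteqP; split=> [y -> i _//|y h].
by apply: eq_from_tnth => i; exact: h.
Qed.

Lemma measurable_cube (x : T) e : measurable (cube x e).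
Proof.
rewrite (_ : cube x e = \bigcap_(i in [set: 'I_d]) ((@tnth _ _)^~ i) @^-1` (ball (tnth x i) e)).
  apply: fin_bigcap_measurable; first exact: finite_finset.
  by move=> i _; rewrite -[X in measurable X]setTI; apply: measurable_tnth => //;
    rewrite ball_itv; exact: measurable_itv.
apply/seteqP; split=> [y h i _|y h i].
  by rewrite /= /ball/= distrC; exact: h.
by have := h i I; rewrite /= /ball/= distrC.
Qed.

Lemma lat_bigcup : \bigcup_v [set lat v] = lattice.
Proof.
rewrite -range_lat; apply/seteqP; split=> [x [v _ ->]|x [v _ <-]]; exists v => //.
Qed.

Lemma lat_trivIset : trivIset [set: V] (fun v => [set lat v]).
Proof.
apply/trivIsetP => v w _ _ vw; apply/seteqP; split=> // x [-> /lat_inj] vw'.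
by move: vw; rewrite vw' eqxx.
Qed.

Lemma measurable_lattice : measurable (@lattice R d).
Proof.
rewrite -range_lat; apply: countable_measurable; last first.
  exact: sub_countable (card_image_le _ _) (countableP _).
by move=> x; exact: measurable_tuple_set1.
Qed.

End lattice.

Section charges_on_lattice.
Context {R : realType} {d : nat}.
Local Notation T := (d.-tuple R).
Local Notation V := 'rV[int]_d.
Local Notation A := (l1 R V).
Local Notation fmeas := {finite_measure set T -> \bar R}.
Local Notation cht := (charge T R).
Local Notation lat := (@lat R d).

(** Every measurable set off the lattice is tested, not just the complement: for a signed measure a
    vanishing total could hide cancellation. In this form the property passes to the Jordan
    parts. *)
Definition on_lattice (f : set T -> \bar R) : Prop :=
  forall B, measurable B -> B `&` lattice = set0 -> f B = 0%E.

Lemma measurable_lat v : measurable [set lat v].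
Proof. exact: measurable_tuple_set1. Qed.

Lemma fmeas_abs_summable (mu : fmeas) :
  abs_summable (fun v => fine (mu [set lat v])).
Proof.
have h : mu lattice = \esum_(v in [set: V]) mu (lattice `&` [set lat v]).
  apply: measure_countable_partition.
  - exact: measurable_lat.
  - exact: lat_trivIset.
  - exact: measurable_lattice.
  - by rewrite lat_bigcup setDv measure0.
apply: (@le_lt_trans _ _ (mu lattice)).
  rewrite h; apply: le_esum => v _; rewrite ger0_norm ?fine_ge0// fineK.
    by rewrite (_ : lattice `&` _ = [set lat v])//; apply/setIidPr => _ ->;
      exact: lat_lattice.
  exact: fin_num_measure (measurable_lat v).
by rewrite ltey_eq (fin_num_measure mu _ measurable_lattice).
Qed.

Definition l1_of_measure (mu : fmeas) : A := L1 (fmeas_abs_summable mu).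

Lemma l1_of_measureE (mu : fmeas) v : mu [set lat v] = (l1_of_measure mu v)%:E.
Proof. by rewrite /= fineK//; exact: fin_num_measure (measurable_lat v). Qed.

Lemma l1_of_measure_ge0 (mu : fmeas) v : 0 <= l1_of_measure mu v.
Proof. exact: fine_ge0. Qed.

(** The product measure is carried by the countably many slices over single lattice points, and on
    each slice it is a rectangle. *)
Lemma mconv_slices (mu nu : fmeas) B : on_lattice mu -> measurable B ->
  mconv mu nu B = \esum_(v in [set: V])
    (mu [set lat v] * nu ((fun y => vadd (lat v, y)) @^-1` B))%E.
Proof.
move=> muL mB; pose E v := [set lat v] `*` [set: T].
have mE v : measurable (E v) by apply: measurableX => //; exact: measurable_lat.
have mP : measurable (@vadd R d @^-1` B).
  by rewrite -[X in measurable X]setTI; exact: measurable_vadd.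
have UE : \bigcup_v E v = lattice `*` [set: T].
  rewrite -lat_bigcup; apply/seteqP.
  split=> [[x y] [v _ [/= xv _]]|[x y] [[v _ /= xv] _]]; last by exists v.
  by split=> //; exists v.
rewrite /mconv /pushforward (@measure_countable_partition _ _ _ (mu \x nu)%E _ E)//.
- apply: eq_esum => v _.
  rewrite (_ : _ `&` E v = [set lat v] `*` ((fun y => vadd (lat v, y)) @^-1` B)).
    apply: product_measure1E; first exact: measurable_lat.
    rewrite -[X in measurable X]setTI.
    by apply: (measurableT_comp measurable_vadd (pair1_measurable (lat v))).
  apply/seteqP; split=> [[x y] [/= Bxy [/= xv _]]|[x y] [/= -> Bxy]].
    by split=> //=; rewrite -xv.
  by split.
- apply/trivIsetP => v w _ _ vw; apply/seteqP; split=> // -[x y] [[/= -> _] [/= /lat_inj vw' _]].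
  by move: vw; rewrite vw' eqxx.
- apply/eqP; rewrite eq_le measure_ge0 andbT UE.
  apply: (@le_trans _ _ ((mu \x nu)%E ((~` lattice) `*` [set: T]))).
    apply: le_measure; rewrite ?inE.
    + by apply: measurableD => //; apply: measurableX => //; exact: measurable_lattice.
    + by apply: measurableX => //; apply: measurableC; exact: measurable_lattice.
    + by move=> [x y] [_ /= h]; split=> // xl; exact: h.
  have mC : measurable (~` @lattice R d) by apply: measurableC; exact: measurable_lattice.
  have mu0 : mu (~` lattice) = 0%E by apply: muL mC _; rewrite setICl.
  have := product_measure1E mu nu mC measurableT.
  by rewrite [X in _ = (X * _)%E]mu0 mul0e => ->.
Qed.

Lemma mconv_on_lattice (mu nu : fmeas) : on_lattice mu -> on_lattice nu ->
  on_lattice (mconv mu nu).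
Proof.
move=> muL nuL B mB BL; rewrite mconv_slices// esum1// => v _.
rewrite nuL ?mule0//.
  rewrite -[X in measurable X]setTI.
  by apply: (measurableT_comp measurable_vadd (pair1_measurable (lat v))).
apply/seteqP; split=> // y [/= By]; rewrite -range_lat => -[w _ wy].
have : (B `&` lattice) (lat (v + w)).
  by split; [rewrite latD wy|exact: lat_lattice].
by rewrite BL.
Qed.

Lemma mconv_lat (mu nu : fmeas) z : on_lattice mu ->
  mconv mu nu [set lat z] = ((l1_of_measure mu * l1_of_measure nu) z)%:E.
Proof.
move=> muL; rewrite mconv_slices//; last exact: measurable_lat.
have -> : (l1_of_measure mu * l1_of_measure nu) z =
    rsum (fun v => l1_of_measure mu v * l1_of_measure nu (z - v)).
  exact: l1_mulE.
rewrite rsum_nnegE; last exact: l1_conv_row.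
  apply: eq_esum => v _.
  rewrite (_ : _ @^-1` _ = [set lat (z - v)]); first by rewrite !l1_of_measureE.
  apply/seteqP; split=> [y /= yz|_ ->/=]; last by rewrite -latD addrC subrK.
  by apply: (@vadd_lat_inj _ _ v) => /=; rewrite yz -latD addrC subrK.
by move=> v; rewrite mulr_ge0// l1_of_measure_ge0.
Qed.

Lemma cpos_on_lattice (M : cht) : on_lattice M -> on_lattice (cpos M).
Proof.
move=> ML B mB BL; rewrite cposE// ML//.
  by have [[mP _] _ _ _] := svalP (hahn M); exact: measurableI.
by rewrite setIAC BL set0I.
Qed.

Lemma cneg_on_lattice (M : cht) : on_lattice M -> on_lattice (cneg M).
Proof.
move=> ML B mB BL; rewrite cnegE// ML ?oppe0//.
  by have [_ [mN _] _ _] := svalP (hahn M); exact: measurableI.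
by rewrite setIAC BL set0I.
Qed.

(** The Jordan parts supply absolute summability; the values are just the point masses of [M], so
    the choice of Hahn sets disappears. *)
Definition l1_of (M : cht) : A := l1_of_measure (cpos M) - l1_of_measure (cneg M).

Lemma l1_ofE (M : cht) v : M [set lat v] = (l1_of M v)%:E.
Proof.
rewrite charge_jordanE; last exact: measurable_lat.
by rewrite !l1_of_measureE -EFinB.
Qed.

Lemma eq_l1_of (M : cht) (a : A) : (forall v, M [set lat v] = (a v)%:E) -> l1_of M = a.
Proof. by move=> h; apply: l1P => v; apply: EFin_inj; rewrite -h l1_ofE. Qed.

Lemma csub_on_lattice (M N : cht) : on_lattice M -> on_lattice N -> on_lattice (csub M N).
Proof.
move=> ML NL B mB BL.
change (M B + - N B = 0)%E.
by rewrite ML// NL// oppe0 adde0.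
Qed.

Lemma l1_of_csub (M N : cht) : l1_of (csub M N) = l1_of M - l1_of N.
Proof.
apply: eq_l1_of => v; change (M [set lat v] + - N [set lat v] = (l1_of M v - l1_of N v)%:E)%E.
by rewrite !l1_ofE.
Qed.

Lemma cscale_on_lattice (c : R) (M : cht) : on_lattice M -> on_lattice (cscale c M).
Proof. by move=> ML B mB BL; rewrite /cscale /= ML// mule0. Qed.

Lemma l1_of_cscale (c : R) (M : cht) : l1_of (cscale c M) = l1_cst c * l1_of M.
Proof.
apply: eq_l1_of => v.
change (c%:E * M [set lat v] = ((l1_cst c * l1_of M) v)%:E)%E.
by rewrite l1_ofE l1_cstM.
Qed.

Lemma unit_on_lattice : on_lattice (@unit_mass R d).
Proof.
move=> B mB BL; rewrite /unit_mass /charge_of_finite_measure /= diracE.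
rewrite memNset// => B0; have : (B `&` lattice) (@vzero R d).
  by split=> //; rewrite -lat0; exact: lat_lattice.
by rewrite BL.
Qed.

Lemma l1_of_unit : l1_of (@unit_mass R d) = 1.
Proof.
apply: eq_l1_of => v; rewrite /unit_mass /charge_of_finite_measure /= diracE -lat0.
rewrite l1_oneE; case: eqP => [->|v0]; first by rewrite mem_set.
by rewrite memNset// => /lat_inj /esym.
Qed.

Lemma conv_on_lattice (M N : cht) : on_lattice M -> on_lattice N ->
  on_lattice (Defs.conv M N).
Proof.
move=> ML NL B mB BL.
have [pM nM pN nN] : [/\ on_lattice (cpos M), on_lattice (cneg M),
    on_lattice (cpos N) & on_lattice (cneg N)].
  by split; [exact: cpos_on_lattice|exact: cneg_on_lattice
            |exact: cpos_on_lattice|exact: cneg_on_lattice].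
change ((mconv (cpos M) (cpos N) B + mconv (cneg M) (cneg N) B)
  - (mconv (cpos M) (cneg N) B + mconv (cneg M) (cpos N) B) = 0)%E.
rewrite !(mconv_on_lattice pM pN, mconv_on_lattice nM nN,
  mconv_on_lattice pM nN, mconv_on_lattice nM pN)//.
by rewrite adde0 sube0.
Qed.

Lemma l1_of_conv (M N : cht) : on_lattice M -> on_lattice N ->
  l1_of (Defs.conv M N) = l1_of M * l1_of N.
Proof.
move=> ML NL; apply: eq_l1_of => z.
have pM := cpos_on_lattice ML; have nM := cneg_on_lattice ML.
change ((mconv (cpos M) (cpos N) [set lat z] + mconv (cneg M) (cneg N) [set lat z])
  - (mconv (cpos M) (cneg N) [set lat z] + mconv (cneg M) (cpos N) [set lat z])
  = ((l1_of M * l1_of N) z)%:E)%E.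
rewrite !mconv_lat// -!EFinD; congr EFin.
rewrite /l1_of; set a := l1_of_measure _; set b := l1_of_measure (cneg M).
set c := l1_of_measure _; set e := l1_of_measure (cneg N).
have -> : (a - b) * (c - e) = (a * c + b * e) - (a * e + b * c) by ring.
by rewrite l1_addE l1_oppE !l1_addE.
Qed.

Lemma conv_pow_lattice (M : cht) k : on_lattice M ->
  on_lattice (conv_pow M k) /\ l1_of (conv_pow M k) = l1_of M ^+ k.
Proof.
move=> ML; elim: k => [|k [IHL IH]] /=.
  by split; [exact: unit_on_lattice|rewrite l1_of_unit].
by split; [exact: conv_on_lattice|rewrite l1_of_conv// IH exprS].
Qed.

Lemma cexp_on_lattice (M : cht) : on_lattice M -> on_lattice (cexp M).
Proof.
move=> ML B mB BL; rewrite /cexp eseries0// => j _ _.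
by have [h _] := conv_pow_lattice j ML; rewrite h// mule0.
Qed.

Lemma l1_of_cexp (M : cht) : on_lattice M -> l1_of (cexp M) = l1_exp (l1_of M).
Proof.
move=> ML; apply: eq_l1_of => v; rewrite l1_expE /= /cexp; apply/cvg_lim => //.
have hs := l1_sum_row v (l1_exp_summable (l1_of M)).
rewrite (_ : (fun n => _) = EFin \o series (fun j => l1_exp_term (l1_of M) j v)).
  by apply: cvg_EFin; [exact: nearW|exact: rsum_nat_cvg].
apply/funext => n /=; rewrite -sumEFin; apply: eq_bigr => j _.
have [_ h] := conv_pow_lattice j ML.
by rewrite l1_ofE h /l1_exp_term l1_cstM.
Qed.

Lemma dTV_l1 (M N : cht) : dTV M N = (2^-1 * l1_norm (l1_of M - l1_of N))%:E.
Proof.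
rewrite /dTV EFinM; congr (_ * _)%E.
rewrite l1_normE -l1_of_csub /tv_norm -range_lat esum_image; last first.
  by move=> v w _ _ /lat_inj.
by apply: eq_esum => v _; rewrite l1_ofE.
Qed.

End charges_on_lattice.

(** * From the support condition on the distribution to a law on the integer lattice *)

Section lattice_law.
Context {R : realType} {d : nat}.
Variable P : probability (d.-tuple R) R.
Local Notation T := (d.-tuple R).
Local Notation V := 'rV[int]_d.
Local Notation lat := (@lat R d).
Hypothesis supp_lattice : supp P `<=` lattice.

(** A point outside the support has a null cube around it. Shrinking to cubes with rational centres
    and radii [1/(k+1)] leaves countably many null sets, whose union is null. *)
Lemma supp_complement_cover : exists2 U : set T, measurable U & P U = 0%E /\
  ~` lattice `<=` U.
Proof.
pose C (ck : d.-tuple rat * nat) : set T :=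
  cube [tuple ratr (tnth ck.1 i) | i < d] ck.2.+1%:R^-1.
pose G n : set T := if unpickle n is Some ck then
  (if P (C ck) == 0%E then C ck else set0) else set0.
have mC ck : measurable (C ck) by exact: measurable_cube.
have mG n : measurable (G n) by rewrite /G; case: unpickle => // ck; case: ifP.
have G0 n : P (G n) = 0%E.
  rewrite /G; case: unpickle => [ck|]; last by rewrite measure0.
  by case: ifP => [/eqP//|_]; rewrite measure0.
exists (\bigcup_n G n); first exact: bigcupT_measurable.
split.
  apply/eqP; rewrite eq_le measure_ge0 andbT.
  apply: le_trans (measure_sigma_subadditive _ _ _ _) _ => //.
  - exact: bigcupT_measurable.
  - by rewrite eseries0// => i _ _; exact: G0.
move=> x xL; have /existsNP[e /not_implyP[e0 /negP]] : ~ supp P x.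
  by move=> /supp_lattice.
rewrite -leNgt => Pe.
(* Twice the radius stays below [e], so a rational cube containing [x] lies inside the null cube at
   [x]. *)
pose k := Num.truncn (2 / e); have ke : 2 / k.+1%:R < e.
  rewrite ltr_pdivrMr// -ltr_pdivrMl// mulrC.
  by rewrite truncnS_gt// divr_ge0// ltW.
have k0 : 0 < k.+1%:R^-1 :> R by rewrite invr_gt0.
have near_rat (z : R) : exists r : rat, `|z - ratr r| < k.+1%:R^-1.
  have zk : z - k.+1%:R^-1 < z + k.+1%:R^-1 by rewrite ltrBlDr -addrA ltrDl addr_gt0.
  have [r] := rat_in_itvoo zk.
  by rewrite in_itv/= => rz; exists r; rewrite distrC ltr_distl.
have [c cx] : exists c : d.-tuple rat, C (c, k) x.
  exists [tuple projT1 (cid (near_rat (tnth x i))) | i < d] => i.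
  by rewrite /= !tnth_mktuple; exact: (projT2 (cid (near_rat (tnth x i)))).
have Csub : C (c, k) `<=` cube x e.
  move=> y yc i; have := yc i; have := cx i; rewrite !tnth_mktuple /= => h1 h2.
  rewrite -(subrKA (ratr (tnth c i))); apply: le_lt_trans (ler_normD _ _) _.
  apply: lt_trans ke; rewrite (_ : 2 / k.+1%:R = k.+1%:R^-1 + k.+1%:R^-1); last by field.
  by rewrite ltrD// distrC.
have PC : P (C (c, k)) = 0%E.
  apply/eqP; rewrite eq_le measure_ge0 andbT; apply: le_trans Pe.
  by apply: le_measure; rewrite ?inE//; exact: measurable_cube.
by exists (pickle (c, k)) => //; rewrite /G pickleK PC eqxx.
Qed.

Lemma law_on_lattice : on_lattice P.
Proof.
move=> B mB BL; have [U mU [PU LU]] := supp_complement_cover.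
apply/eqP; rewrite eq_le measure_ge0 andbT -PU.
apply: le_measure; rewrite ?inE// => x Bx; apply: LU => xl.
by have : (B `&` lattice) x by []; rewrite BL.
Qed.

Lemma supp_lat v : P [set lat v] != 0%E -> supp P (lat v).
Proof.
move=> Pv e e0; apply: (@lt_le_trans _ _ (P [set lat v])).
  by rewrite lt_neqAle eq_sym Pv measure_ge0.
apply: le_measure; rewrite ?inE.
- exact: measurable_lat.
- exact: measurable_cube.
- by move=> _ -> i; rewrite subrr normr0.
Qed.

Let F := l1_of (charge_of_finite_measure P).

Lemma lawE v : P [set lat v] = (F v)%:E.
Proof. exact: (l1_ofE (charge_of_finite_measure P) v). Qed.

Lemma law_ge0 v : 0 <= F v.
Proof. by rewrite -lee_fin -lawE measure_ge0. Qed.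

Lemma law_is_law q : P [set vzero] = q%:E -> is_law F q.
Proof.
move=> Pq; split; first exact: law_ge0.
- apply: EFin_inj; rewrite rsum_nnegE; [|exact: law_ge0|exact: l1_summable].
  rewrite -(@probability_setT _ _ _ P).
  rewrite (@measure_countable_partition _ _ _ P _ (fun v : V => [set lat v]))//.
  + by apply: eq_esum => v _; rewrite setTI; exact/esym/lawE.
  + exact: measurable_lat.
  + exact: lat_trivIset.
  + apply: law_on_lattice.
      by apply: measurableD => //; rewrite lat_bigcup; exact: measurable_lattice.
    by rewrite lat_bigcup setTD setICl.
- by apply: EFin_inj; rewrite -lawE lat0.
Qed.

(** [min (1, 4 y F x) = y min (4 F x, 1/y)], and a lattice point outside the support has mass 0, so
    it adds nothing to the sum over all nonzero points. *)
Lemma delta_min_sum q y : P [set vzero] = q%:E -> 0 < y ->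
  delta P y = y * min_sum F y^-1.
Proof.
move=> Pq y0; have FL := law_is_law Pq.
have yV0 : 0 <= y^-1 by rewrite invr_ge0 ltW.
rewrite -rsumZ; last exact: (min_sum_summable FL yV0).
pose W := [set v : V | supp P (lat v) /\ v != 0].
have WE : supp P `\` [set vzero] = lat @` W.
  apply/seteqP; split=> [x [xs x0]|_ [v [vs v0] <-]].
    have := supp_lattice xs; rewrite -range_lat => -[v _ vx].
    exists v => //; split; first by rewrite vx.
    by apply/eqP => v0; apply: x0; rewrite -vx v0 lat0.
  split=> //; rewrite -lat0 => /= /lat_inj v0'.
  by move: v0; rewrite v0' eqxx.
rewrite /delta WE esum_image; last by move=> v w _ _ /lat_inj.
rewrite esum_mkcond -[RHS]/(fine (_ )%:E) rsum_nnegE; last first.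
- exact/abs_summableZ/(min_sum_summable FL yV0).
- move=> v; rewrite mulr_ge0 ?(ltW y0)//; case: ifP => // _.
  by rewrite le_min yV0 mulr_ge0 ?law_ge0.
congr fine; apply: eq_esum => v _; case: ifPn; rewrite ?inE ?notin_setE.
  move=> [vs v0]; rewrite (negbTE v0) lawE /=; congr EFin.
  rewrite minr_pMr ?(ltW y0)// mulfV ?gt_eqF// minC; congr Num.min.
  by ring.
move=> h; case: eqP => [_|/eqP v0]; first by rewrite mulr0.
have Fv : F v = 0.
  apply: EFin_inj; rewrite -lawE; apply: contra_notP h => /eqP Pv.
  by split=> //; exact: supp_lat.
by rewrite Fv mulr0 min_l// mulr0.
Qed.

End lattice_law.

Lemma powR_half (R : realType) (q : R) n : 0 <= q ->
  q `^ (n%:R / 2) = Num.sqrt q ^+ n.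
Proof.
move=> q0; rewrite mulrC powRrM powR12_sqrt// powR_mulrn// sqrtr_ge0.
Qed.

Lemma approx_D_lattice (R : realType) (d : nat) (F : charge (d.-tuple R) R) :
  on_lattice F -> on_lattice (approx_D F) /\
  l1_of (approx_D F) = l1_exp ((l1_of F - 1) - l1_cst 2^-1 * (l1_of F - 1) ^+ 2).
Proof.
move=> FL; have uL := csub_on_lattice FL (@unit_on_lattice R d).
have [u2L u2E] := conv_pow_lattice 2 uL.
have tL := csub_on_lattice uL (cscale_on_lattice (2^-1 : R) u2L).
split; first exact: cexp_on_lattice.
have e1 := l1_of_csub F (@unit_mass R d); rewrite l1_of_unit in e1.
apply: (etrans (l1_of_cexp tL)); apply: (congr1 (@l1_exp R _)).
apply: (etrans (l1_of_csub _ _)).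
by rewrite (l1_of_cscale _ (conv_pow (csub F (@unit_mass R d)) 2)) u2E e1.
Qed.

Theorem theorem2 (R : realType) :
  exists C : R, 0 < C /\
  forall (d : nat) (P : probability (d.-tuple R) R),
    (0 < d)%N ->
    supp P `<=` lattice ->
    symmetric_on_lattice P ->
    forall q : R, P [set vzero] = q%:E -> 0 < q < 1 ->
    let F : {charge set (d.-tuple R) -> \bar R} := charge_of_finite_measure P in
    let D := approx_D F in
    forall n : nat, (0 < n)%N ->
      (dTV (conv_pow F n) (conv_pow D n) <=
        ((1575 / 100) * delta P (n%:R * q / 6) ^+ 3 / (q `^ (7 / 2) * n%:R ^+ 2)
           * (1 + C / (q `^ (7 / 2) * Num.sqrt n%:R))
         + C * (1 - q) `^ (15 / 2) / (q ^+ 8 * n%:R ^+ 2 * Num.sqrt n%:R))%:E)%E.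
Proof.
pose K0 : R := 1 + 16 * expR 4.
have K00 : 0 < K0 by rewrite addr_gt0// mulr_gt0// expR_gt0.
pose C := 216 / 15 * (7 * K0 + (1 + 2 * K0) ^+ 2 * 32 ^+ 3 * 14 ^+ 3).
have C0 : 0 < C.
  apply: mulr_gt0; first by apply: divr_gt0; rewrite ltr0n.
  apply: addr_gt0; first exact: mulr_gt0.
  apply: mulr_gt0; last exact: exprn_gt0.
  apply: mulr_gt0; last exact: exprn_gt0.
  by apply: exprn_gt0; apply: addr_gt0 => //; exact: mulr_gt0.
exists C; split; first exact: C0.
move=> d P _ PL Psym q Pq /andP[q0 q1] F D n n0.
have FL : on_lattice F := law_on_lattice PL.
have [DL DE] := approx_D_lattice FL.
have [_ FnE] := conv_pow_lattice n FL; have [_ DnE] := conv_pow_lattice n DL.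
have law := law_is_law PL Pq.
have Fsym v : l1_of F (- v) = l1_of F v.
  apply: EFin_inj; rewrite -!lawE latN -Psym//; exact: lat_lattice.
have y0 : 0 < n%:R * q / 6 by rewrite divr_gt0// mulr_gt0// ltr0n.
rewrite dTV_l1 lee_fin FnE DnE DE (delta_min_sum PL Pq y0) invf_div.
rewrite powR_half ?(ltW q0)//.
have bound := law_approx_bound law q0 q1 Fsym n0 (lexx (expR 4)) (erefl K0).
(* The first summand already bounds the distance, so for the second only nonnegativity has to be
   checked. *)
apply: le_trans bound _; rewrite -/C lerDl.
apply: divr_ge0; first by apply: mulr_ge0 (ltW C0) _; exact: powR_ge0.
apply: mulr_ge0; last exact: sqrtr_ge0.
by apply: mulr_ge0; apply: exprn_ge0; [exact: ltW|exact: ler0n].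
Qed.
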